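(* The plan existence problem $\mathsf{PlanEx}\text{-}\mathcal{T}_{\mathrm{ALL}}$ is undecidable, where $\mathcal{T}_{\mathrm{ALL}}$ is the class of all attention planning tasks $T=(s_0,\Sigma,\varphi_g)$ with $\Sigma$ a finite set of arbitrary attention actions. That is, there is no algorithm which, given $T\in\mathcal{T}_{\mathrm{ALL}}$, decides whether $T$ has a solution.
   Context: Language. $I\neq\emptyset$ is a finite set of agents, $N\in\mathbb{N}=\{0,1,2,\dots\}$ an attention bound, $\Phi$ a countable set of proposition atoms, $\Psi=\{(\alpha_i<n),(\alpha_i=n): n\le N, i\in I\}$ the set of attention atoms, $At=\Phi\uplus\Psi$. The language $\mathcal{L}$ is $\varphi::=\top\mid p\mid\neg\varphi\mid\varphi\wedge\varphi\mid K_i\varphi$ with $p\in At$, $i\in I$. Attention states. An attention model is $M=(W,R,V,A)$ with $W\ne\emptyset$ a finite set of worlds; $R$ assigning to each $i\in I$ an equivalence relation $R_i$ on $W$; $V:At\to\mathcal{P}(W)$ a valuation; and $A:I\times W\to\{0,\dots,N\}$ such that $wR_iv$ implies $A_i(w)=A_i(v)$. For $w\in W$, $(M,w)$ is an attention state, with actual world $w$. Satisfaction: $M,w\vDash p$ iff $w\in V(p)$ for $p\in\Phi$; $M,w\vDash(\alpha_i=n)$ iff $A_i(w)=n$; $M,w\vDash(\alpha_i<n)$ iff $A_i(w)<n$; $M,w\vDash K_i\varphi$ iff $M,v\vDash\varphi$ for all $v$ with $wR_iv$; standard clauses for $\top,\neg,\wedge$. Write $\varphi\vDash\psi$ if every attention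 state satisfies $\varphi\to\psi$. Attention actions. An attention action model is $\mathcal{A}=(E,Q,Q^*,pre,c)$ with $E\neq\emptyset$ a finite set of events; $Q,Q^*$ assigning to each $i\in I$ equivalence relations $Q_i,Q_i^*$ on $E$; $pre:E\to\mathcal{L}$; and a cost function $c:I\times\mathcal{L}\times E\to\mathbb{N}$ with $c_i(\top,e)=0$ and such that $(e,e')\in Q_i\cup Q_i^*$ implies $c_i(\varphi,e)=c_i(\varphi,e')$, for all $i,\varphi$. A question map is a map $\mathsf{q}:I\to\mathcal{L}$. An attention action is a triple $X=(\mathcal{A},\mathsf{q},e)$ with $e\in E$ (the actual event). $\mathrm{ALL}$ is the class of all attention actions. Attention update. Let $Q_i^*[\varphi|\neg\varphi]$ be the set of $(e,e')\in Q_i^*$ such that ($pre(e)\vDash\varphi$ iff $pre(e')\vDash\varphi$). The update of $(M,w)=((W,R,V,A),w)$ with $X=((E,Q,Q^*,pre,c),\mathsf{q},e)$ is $(M,w)^X=((W^X,R^X,V^X,A^X),(w,e))$, where $W^X=\{(v,f)\in W\times E: M,v\vDash pre(f)\}$; $((v,f),(u,g))\in R_i^X$ iff $(v,u)\in R_i$ and $(f,g)\in Q_i\cup Q_i^*$ in case $c_i(\mathsf{q}_i,f)>A_i(v)$, respectively $(f,g)\in Q_i\cup Q_i^*[\mathsf{q}_i|\neg\mathsf{q}_i]$ in case $c_i(\mathsf{q}_i,f)\le A_i(v)$; $V^X(p)=\{(v,f)\in W^X: v\in V(p)\}$ for $p\in\Phi$; $A_i^X(v,f)=\max\{0,A_i(v)-c_i(\mathsf{q}_i,f)\}$.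 $X$ is applicable to $(M,w)$ if $M,w\vDash pre(e)$. A sequence $X_1,\dots,X_n$ is applicable to $(M,w)$ if each $X_{k+1}$ is applicable to the result of updating successively with $X_1,\dots,X_k$; the final result is $(M,w)^{X_1,\dots,X_n}$. (Satisfaction and updates on updated structures are given by the same clauses.) Planning. An attention planning task is $T=(s_0,\Sigma,\varphi_g)$ with $s_0$ an attention state, $\Sigma$ a finite set of attention actions, $\varphi_g\in\mathcal{L}$. A solution to $T$ is a finite sequence $X_1,\dots,X_n$ of actions from $\Sigma$ applicable to $s_0$ with $s_0^{X_1,\dots,X_n}\vDash\varphi_g$. $\mathcal{T}_{\mathrm{ALL}}$ is the class of all attention planning tasks, and $\mathsf{PlanEx}\text{-}\mathcal{T}_{\mathrm{ALL}}$ is the decision problem: given $T\in\mathcal{T}_{\mathrm{ALL}}$, does $T$ have a solution? The agent set $I$ and bound $N$ are arbitrary and part of the instance; an instance is given by finite data (only finitely many atoms of $\Phi$ and the cost values $c_i(\mathsf{q}_i,f)$ are relevant). *)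

(* Defs.v *)
From HB Require Import structures.
From mathcomp Require Import all_boot.
From mathcomp Require Import boolp.

Set Implicit Arguments.
Unset Strict Implicit.
Unset Printing Implicit Defensive.

(** * Partial recursive functions and algorithmic decidability *)

Inductive recfun : nat -> Type :=
| RZero : recfun 0
| RSucc : recfun 1
| RProj n (i : 'I_n) : recfun n
| RComp m n (f : recfun m) (g : 'I_m -> recfun n) : recfun n
| RPrec n (f : recfun n) (g : recfun n.+2) : recfun n.+1
| RMu n (f : recfun n.+1) : recfun n.

(* [rec_eval f v y]: the partial function denoted by f is defined at v and has
   value y there.  The recursion (resp. search) variable comes first. *)
Fixpoint rec_eval n (f : recfun n) : n.-tuple nat -> nat -> Prop :=
  match f in recfun n return n.-tuple nat -> nat -> Prop with
  | RZero => fun _ y => y = 0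
  | RSucc => fun v y => y = (thead v).+1
  | RProj _ i => fun v y => y = tnth v i
  | RComp m _ f g => fun v y =>
      exists w : m.-tuple nat,
        (forall j, rec_eval (g j) v (tnth w j)) /\ rec_eval f w y
  | RPrec _ f g => fun v y =>
      (fix iter k y := match k with
       | 0 => rec_eval f (behead_tuple v) y
       | k'.+1 => exists z, iter k' z /\
                    rec_eval g [tuple of k' :: z :: behead_tuple v] y
       end) (thead v) y
  | RMu _ f => fun v y =>
      rec_eval f [tuple of y :: v] 0 /\
      forall k, k < y -> exists z, rec_eval f [tuple of k :: v] z.+1
  end.

(* Instances a : T of the problem P are given to the algorithm as the number
   [code a]; nothing is required of it on numbers which code no instance. *)
Definition rec_decidable (T : Type) (code : T -> nat) (P : T -> Prop) : Prop :=
  exists f : recfun 1, forall a : T,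
    (P a -> rec_eval f [tuple code a] 1) /\
    (~ P a -> rec_eval f [tuple code a] 0).

(** * Language *)

Inductive atom (Phi I : Type) (N : nat) : Type :=
| PropAtom (p : Phi)
| AttLt (i : I) (n : 'I_N.+1)
| AttEq (i : I) (n : 'I_N.+1).

Inductive form (Phi I : Type) (N : nat) : Type :=
| Top
| At (a : atom Phi I N)
| Neg (f : form Phi I N)
| And (f g : form Phi I N)
| Know (i : I) (f : form Phi I N).

Arguments Top {Phi I N}.

(** * Attention states *)

(* An update need not be an attention model, because the union of two
   equivalence relations need not be transitive.  Satisfaction and update are
   therefore defined on arbitrary structures of the same shape.  Only the atoms
   of Phi need a valuation: attention atoms are interpreted by [att]. *)
Record structure (Phi : countType) (I : finType) := Structure {
  world : finType;
  acc : I -> rel world;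
  val_of : Phi -> {set world};
  att : I -> world -> nat
}.

Definition attention_model (Phi : countType) (I : finType) (N : nat)
    (M : structure Phi I) : Prop :=
  [/\ 0 < #|world M|,
      forall i, equivalence_rel (@acc _ _ M i),
      forall i (w v : world M), acc i w v -> att i w = att i v
    & forall i (w : world M), att i w <= N].

Definition sat_atom (Phi : countType) (I : finType) (N : nat)
    (M : structure Phi I) (w : world M) (a : atom Phi I N) : bool :=
  match a with
  | PropAtom p => w \in val_of M p
  | AttLt i n => att i w < n
  | AttEq i n => att i w == n
  end.

Fixpoint sat (Phi : countType) (I : finType) (N : nat)
    (M : structure Phi I) (w : world M) (f : form Phi I N) : bool :=
  match f with
  | Top => true
  | At a => sat_atom w a
  | Neg f => ~~ sat w f
  | And f g => sat w f && sat w g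
  | Know i f => [forall v, acc i w v ==> sat v f]
  end.

Definition entails (Phi : countType) (I : finType) (N : nat)
    (f g : form Phi I N) : Prop :=
  forall M : structure Phi I, attention_model N M ->
  forall w : world M, sat w f -> sat w g.

Record pointed (Phi : countType) (I : finType) := Pointed {
  str_of : structure Phi I;
  point : world str_of
}.

(** * Attention actions *)

Record action_model (Phi : countType) (I : finType) (N : nat) := ActionModel {
  event : finType;
  event_gt0 : 0 < #|event|;
  Q : I -> rel event;
  Qs : I -> rel event;
  pre : event -> form Phi I N;
  cost : I -> form Phi I N -> event -> nat;
  Q_equiv : forall i, equivalence_rel (Q i);
  Qs_equiv : forall i, equivalence_rel (Qs i);
  cost_top : forall i e, cost i Top e = 0;
  cost_inv : forall i f e e', Q i e e' || Qs i e e' -> cost i f e = cost i f e'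
}.

Record action (Phi : countType) (I : finType) (N : nat) := Action {
  model_of : action_model Phi I N;
  question : I -> form Phi I N;
  actual : event model_of
}.

(** * Attention update *)

(* Q_i^*[f | ~ f] *)
Definition Qs_split (Phi : countType) (I : finType) (N : nat)
    (A : action_model Phi I N) (i : I) (f : form Phi I N) : rel (event A) :=
  fun e e' => Qs i e e' && `[< entails (pre e) f <-> entails (pre e') f >].

Section Update.
Context {Phi : countType} {I : finType} {N : nat}.
Context (M : structure Phi I) (X : action Phi I N).
Let A := model_of X.

Definition upd_world : finType :=
  {x : world M * event A | sat x.1 (pre x.2)}.

Definition upd_acc (i : I) : rel upd_world := fun x y =>
  let: (v, f) := val x in
  let: (u, g) := val y in
  acc i v u &&
  (Q i f g ||
   if att i v < cost i (question X i) f then Qs i f g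
   else Qs_split i (question X i) f g).

Definition upd : structure Phi I := {|
  world := upd_world;
  acc := upd_acc;
  val_of := fun p => [set x : upd_world | (val x).1 \in val_of M p];
  (* truncated subtraction *)
  att := fun i (x : upd_world) =>
    att i (val x).1 - cost i (question X i) (val x).2
|}.

End Update.

Definition applicable (Phi : countType) (I : finType) (N : nat)
    (s : pointed Phi I) (X : action Phi I N) : Prop :=
  sat (point s) (pre (actual X)).

Definition update (Phi : countType) (I : finType) (N : nat)
    (s : pointed Phi I) (X : action Phi I N) (h : applicable s X) :
    pointed Phi I :=
  @Pointed Phi I (upd (str_of s) X)
    (exist (fun x : world (str_of s) * event (model_of X) =>
              is_true (sat x.1 (pre x.2)))
           (point s, actual X) h).

(* The sequence Xs is applicable to s, with final result t. *)
Fixpoint yields (Phi : countType) (I : finType) (N : nat)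
    (s : pointed Phi I) (Xs : seq (action Phi I N)) (t : pointed Phi I) : Prop :=
  match Xs with
  | [::] => t = s
  | X :: Xs' => exists h : applicable s X, yields (update h) Xs' t
  end.

(** * Planning *)

(* The finite set of actions is a finite family. *)
Record task (Phi : countType) := Task {
  agent : finType;
  agent_gt0 : 0 < #|agent|;
  bound : nat;
  init : pointed Phi agent;
  init_ok : attention_model bound (str_of init);
  nact : nat;
  act : 'I_nact -> action Phi agent bound;
  goal : form Phi agent bound
}.

Definition solution (Phi : countType) (T : task Phi) (plan : seq 'I_(nact T)) :
    Prop :=
  exists t, yields (init T) [seq act k | k <- plan] t /\ sat (point t) (goal T).

Definition has_solution (Phi : countType) (T : task Phi) : Prop :=
  exists plan, solution (T := T) plan.

(** * Instances as finite data *)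

(* Agents, worlds and events are numbered by their rank in the enumeration of
   the respective finite type, propositional atoms by [pickle], and functions on
   a finite type are listed in the order of its enumeration.  The resulting
   finite datum lies in a countable type and is coded by [pickle]. *)

Fixpoint form_data (Phi : countType) (I : finType) (N : nat)
    (f : form Phi I N) : GenTree.tree nat :=
  match f with
  | Top => GenTree.Node 0 [::]
  | At (PropAtom p) => GenTree.Node 1 [:: GenTree.Leaf (pickle p)]
  | At (AttLt i n) =>
      GenTree.Node 2 [:: GenTree.Leaf (enum_rank i : nat);
                         GenTree.Leaf (n : nat)]
  | At (AttEq i n) =>
      GenTree.Node 3 [:: GenTree.Leaf (enum_rank i : nat);
                         GenTree.Leaf (n : nat)]
  | Neg f => GenTree.Node 4 [:: form_data f]
  | And f g => GenTree.Node 5 [:: form_data f; form_data g]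
  | Know i f =>
      GenTree.Node 6 [:: GenTree.Leaf (enum_rank i : nat); form_data f]
  end.

Fixpoint prop_atoms (Phi : countType) (I : finType) (N : nat)
    (f : form Phi I N) : seq Phi :=
  match f with
  | Top => [::]
  | At (PropAtom p) => [:: p]
  | At _ => [::]
  | Neg f => prop_atoms f
  | And f g => prop_atoms f ++ prop_atoms g
  | Know _ f => prop_atoms f
  end.

Definition rel_data (T : finType) (r : rel T) : seq (seq bool) :=
  [seq [seq r x y | y : T] | x : T].

(* The valuation is listed only for the atoms in ps. *)
Definition state_data (Phi : countType) (I : finType) (ps : seq Phi)
    (s : pointed Phi I) :=
  let M := str_of s in
  (#|world M|,
   [seq rel_data (@acc _ _ M i) | i : I],
   [seq (pickle p, [seq w \in val_of M p | w : world M]) | p <- ps],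
   [seq [seq att i w | w : world M] | i : I],
   (enum_rank (point s) : nat)).

(* Of the cost function, only the values c_i(q_i, e) are listed. *)
Definition action_data (Phi : countType) (I : finType) (N : nat)
    (X : action Phi I N) :=
  let E := event (model_of X) in
  (#|E|,
   [seq rel_data (@Q _ _ _ (model_of X) i) | i : I],
   [seq rel_data (@Qs _ _ _ (model_of X) i) | i : I],
   [seq form_data (pre e) | e : E],
   [seq [seq cost i (question X i) e | e : E] | i : I],
   [seq form_data (question X i) | i : I],
   (enum_rank (actual X) : nat)).

Definition action_atoms (Phi : countType) (I : finType) (N : nat)
    (X : action Phi I N) : seq Phi :=
  flatten [seq prop_atoms (pre e) | e : event (model_of X)] ++
  flatten [seq prop_atoms (question X i) | i : I].

Definition task_atoms (Phi : countType) (T : task Phi) : seq Phi :=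
  undup (flatten [seq action_atoms (act k) | k : 'I_(nact T)] ++
         prop_atoms (goal T)).

Definition task_data (Phi : countType) (T : task Phi) :=
  (#|agent T|,
   bound T,
   state_data (task_atoms T) (init T),
   [seq action_data (act k) | k : 'I_(nact T)],
   form_data (goal T)).

Definition task_code (Phi : countType) (T : task Phi) : nat :=
  pickle (task_data T).

(* Main.v *)
(* Counter machines are simulated by planning tasks.  The value of a register is
   the length of a chain of worlds which ends at a seed world: an increment
   splits a new world off the seed at that end, a decrement deletes the world at
   the other end.  The union of the two equivalence relations of an action need
   not be transitive, so that one agent suffices for the links of all chains.  A
   total relation serves as a global modality, and attention values serve as
   labels of worlds and as input registers, which can only be decremented.

   A machine is described by two numbers, and the task in which these numbers
   are also the values of its two input registers has a code which is a
   computable function of them.  If f decided the problem, there would be a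
   machine which computes this code k from its inputs and accepts iff f(k) = 0.
   The task of this machine has a solution iff f says that it has none. *)

Require Import Defs.
From mathcomp Require Import all_boot.
From HB Require Import structures.
From mathcomp Require Import boolp zify.

Set Implicit Arguments.
Unset Strict Implicit.
Unset Printing Implicit Defensive.

(** * Computable functions *)

Lemma rec_eval_fun n (f : recfun n) v y y' :
  rec_eval f v y -> rec_eval f v y' -> y = y'.
Proof.
elim: f v y y' => {n} //= [||n i|m n f IHf g IHg|n f IHf g IHg|n f IHf] v y y'.
- by move=> -> ->.
- by move=> -> ->.
- by move=> -> ->.
- move=> [w [gw fw]] [w' [gw' fw']]; apply: (IHf w) => //.
  suff -> : w = w' by [].
  by apply: eq_from_tnth => j; apply: IHg (gw j) (gw' j).
- elim: (thead v) y y' => [|k IHk] y y'; first exact: IHf.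
  by move=> [z [kz gz]] [z' [/(IHk _ _ kz) <-]]; apply: IHg gz.
- move=> [f0 fS] [f0' fS']; case: (ltngtP y y') => // lt_y.
  + by have [z /(IHf _ _ _ f0)] := fS' _ lt_y.
  + by have [z /(IHf _ _ _ f0')] := fS _ lt_y.
Qed.

Definition computable n (F : n.-tuple nat -> nat) :=
  exists f : recfun n, forall v y, rec_eval f v y <-> y = F v.

Lemma computable_ext n (F G : n.-tuple nat -> nat) :
  F =1 G -> computable F -> computable G.
Proof. by move=> eqFG [f fP]; exists f => v y; rewrite -eqFG. Qed.

Lemma computable_proj n (i : 'I_n) : computable (fun v => tnth v i).
Proof. by exists (RProj i). Qed.

Lemma computable_comp m n (F : m.-tuple nat -> nat)
    (G : 'I_m -> n.-tuple nat -> nat) :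
  computable F -> (forall i, computable (G i)) ->
  computable (fun v => F [tuple G i v | i < m]).
Proof.
move=> [f fP] /(_ _)/cid gP; exists (RComp f (fun i => sval (gP i))) => v y /=.
split=> [[w [gw /fP ->]]|->].
  congr F; apply: eq_from_tnth => i; rewrite tnth_mktuple.
  exact/(svalP (gP i)).
exists [tuple G i v | i < m]; split; last exact/fP.
by move=> i; apply/(svalP (gP i)); rewrite tnth_mktuple.
Qed.

Lemma computable_zero n : computable (fun _ : n.-tuple nat => 0).
Proof.
have zP : computable (fun _ : 0.-tuple nat => 0) by exists RZero.
by apply: (computable_comp (G := fun _ _ => 0) zP) => -[].
Qed.

Lemma computable_comp1 n (op : nat -> nat) (F : n.-tuple nat -> nat) :
  computable (fun v : 1.-tuple nat => op (thead v)) -> computable F ->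
  computable (fun v => op (F v)).
Proof.
move=> opP FP; have := computable_comp (G := fun _ => F) opP (fun _ => FP).
by apply: computable_ext => v; rewrite /thead tnth_mktuple.
Qed.

Lemma computable_comp2 n (op : nat -> nat -> nat) (F G : n.-tuple nat -> nat) :
  computable (fun v : 2.-tuple nat => op (thead v) (tnth v ord_max)) ->
  computable F -> computable G -> computable (fun v => op (F v) (G v)).
Proof.
move=> opP FP GP.
have GP' (i : 'I_2) : computable (if i == 0 :> nat then F else G) by case: ifP.
apply: computable_ext (computable_comp opP GP') => v.
by rewrite /thead !tnth_mktuple.
Qed.

Lemma computable_rec n (F : n.-tuple nat -> nat) (G : n.+2.-tuple nat -> nat) :
  computable F -> computable G ->
  computable (fun v : n.+1.-tuple nat =>
    nat_rect (fun _ => nat) (F (behead_tuple v))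
      (fun k z => G [tuple of k :: z :: behead_tuple v]) (thead v)).
Proof.
move=> [f fP] [g gP]; exists (RPrec f g) => v /=.
elim: (thead v) => [|k IHk] y /=; first exact: fP.
split=> [[z [/IHk -> /gP //]]|->]; eexists; split; first exact/IHk.
exact/gP.
Qed.

Lemma computable_succ n (F : n.-tuple nat -> nat) :
  computable F -> computable (fun v => (F v).+1).
Proof. by apply: computable_comp1; exists RSucc. Qed.

Lemma computable_const n k : computable (fun _ : n.-tuple nat => k).
Proof.
elim: k => [|k]; [exact: computable_zero | exact: computable_succ].
Qed.

Lemma computable_add n (F G : n.-tuple nat -> nat) :
  computable F -> computable G -> computable (fun v => F v + G v).
Proof.
apply: computable_comp2.
have := computable_rec (computable_proj (ord0 : 'I_1))
  (computable_succ (computable_proj (Ordinal (isT : 1 < 3)))).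
apply: computable_ext => v.
rewrite (tnth_nth 0) [tnth v _](tnth_nth 0) /= nth_behead.
by elim: (thead v) => [|k /= IHk] //=; rewrite (tnth_nth 0) /= IHk.
Qed.

Lemma computable_mul n (F G : n.-tuple nat -> nat) :
  computable F -> computable G -> computable (fun v => F v * G v).
Proof.
apply: computable_comp2.
have := computable_rec (computable_const 1 0)
  (computable_add (computable_proj (Ordinal (isT : 2 < 3)))
                  (computable_proj (Ordinal (isT : 1 < 3)))).
apply: computable_ext => v.
rewrite [tnth v _](tnth_nth 0).
elim: (thead v) => [|k /= IHk] //=.
by rewrite !(tnth_nth 0) /= IHk nth_behead mulSn.
Qed.

Lemma computable_pow2 n (F : n.-tuple nat -> nat) :
  computable F -> computable (fun v => 2 ^ F v).
Proof.
apply: computable_comp1.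
have := computable_rec (computable_const 0 1)
  (computable_mul (computable_const _ 2)
                  (computable_proj (Ordinal (isT : 1 < 2)))).
apply: computable_ext => v.
by elim: (thead v) => [|k /= IHk] //=; rewrite (tnth_nth 0) /= IHk expnS.
Qed.

(** [CodeSeq.code (x :: s)] is 2^x (2c + 1), where c is the code of [s]. *)
Lemma computable_code_cons n (F G : n.-tuple nat -> nat)
    (s : n.-tuple nat -> seq nat) :
  computable F -> computable (fun v => CodeSeq.code (s v)) ->
  computable (fun v => CodeSeq.code (F v :: s v)).
Proof.
move=> FP sP.
have := computable_mul (computable_pow2 FP)
  (computable_succ (computable_mul (computable_const n 2) sP)).
by apply: computable_ext => v; rewrite /= mul2n.
Qed.

Lemma computable_code_map n (T : Type) (F : T -> n.-tuple nat -> nat) s :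
  (forall x, computable (F x)) ->
  computable (fun v => CodeSeq.code [seq F x v | x <- s]).
Proof.
move=> FP; elim: s => [|x s IHs] /=; first exact: computable_const.
exact: computable_code_cons.
Qed.

Lemma computable_pickle_pair n (T U : countType)
    (x : n.-tuple nat -> T) (y : n.-tuple nat -> U) :
  computable (fun v => pickle (x v)) -> computable (fun v => pickle (y v)) ->
  computable (fun v => pickle (x v, y v)).
Proof.
move=> xP yP.
(* A pair is pickled as the list of the codes of its two components, by conversion. *)
have pair_code v : pickle (x v, y v) =
    CodeSeq.code [:: pickle (x v); pickle (y v)] by [].
apply: computable_ext (fun v => esym (pair_code v)) _.
do 2![apply: computable_code_cons => //]; exact: computable_const.
Qed.

Lemma computable_pickle_seq n (T : Type) (U : countType)
    (F : T -> n.-tuple nat -> U) s :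
  (forall x, computable (fun v => pickle (F x v))) ->
  computable (fun v => pickle [seq F x v | x <- s]).
Proof.
move=> FP; apply: computable_ext (computable_code_map s FP) => v.
rewrite [RHS](_ : _ = CodeSeq.code (map pickle [seq F x v | x <- s])) //.
by rewrite -map_comp.
Qed.

(** * Counter programs *)

Definition store := nat -> nat.

Definition put (s : store) (r v : nat) : store :=
  fun r' => if r' == r then v else s r'.

Lemma put_eq s r v : put s r v r = v.
Proof. by rewrite /put eqxx. Qed.

Lemma put_neq s r v r' : r' != r -> put s r v r' = s r'.
Proof. by rewrite /put => /negPf ->. Qed.

Lemma put_id s r : put s r (s r) = s.
Proof. by apply/funext => r'; rewrite /put; case: eqP => // ->. Qed.

Lemma put_put s r v v' : put (put s r v) r v' = put s r v'.
Proof. by apply/funext => r'; rewrite /put; case: eqP. Qed.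

(* Registers 0 and 1 hold the input and cannot be incremented.  The boolean of
   [Inc] tells whether the register is positive beforehand. *)
Inductive op :=
| Nop
| Inc (r : nat) (b : bool)
| Dec (r : nat)
| Test (r : nat) (b : bool).

HB.instance Definition _ := gen_eqMixin op.

Definition guard (o : op) (s : store) : bool :=
  match o with
  | Nop => true
  | Inc r b => (1 < r) && ((0 < s r) == b)
  | Dec r => 0 < s r
  | Test r b => (0 < s r) == b
  end.

Definition effect (o : op) (s : store) : store :=
  match o with
  | Inc r _ => put s r (s r).+1
  | Dec r => put s r (s r).-1
  | _ => s
  end.

Inductive rtc (T : Type) (R : T -> T -> Prop) (x : T) : T -> Prop :=
| rtc_refl : rtc R x x
| rtc_step y z : R x y -> rtc R y z -> rtc R x z.

Lemma rtc_trans T (R : T -> T -> Prop) x y z :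
  rtc R x y -> rtc R y z -> rtc R x z.
Proof. by elim=> [//|{}x y' {}y xy' _ IH /IH]; apply: rtc_step. Qed.

(** Regular programs as in dynamic logic. Their nondeterminism matches plan existence: halting means
    that some run terminates. *)
Inductive cmd :=
| Op (o : op)
| Seq (c d : cmd)
| Alt (c d : cmd)
| Star (c : cmd).

HB.instance Definition _ := gen_eqMixin cmd.

Fixpoint sem (c : cmd) : store -> store -> Prop :=
  match c with
  | Op o => fun s t => guard o s /\ t = effect o s
  | Seq c d => fun s t => exists2 u, sem c s u & sem d u t
  | Alt c d => fun s t => sem c s t \/ sem d s t
  | Star c => rtc (sem c)
  end.

Definition Succ r := Alt (Op (Inc r false)) (Op (Inc r true)).
Definition While_dec r c :=
  Seq (Star (Seq (Op (Dec r)) c)) (Op (Test r false)).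
Definition Clear r := While_dec r (Op Nop).
Definition Move x y := While_dec x (Succ y).
(* [Copy x y] uses the register y + 1, which must contain 0. *)
Definition Copy x y :=
  Seq (While_dec x (Seq (Succ y) (Succ y.+1))) (Move y.+1 x).

Lemma sem_seq c d s t : sem (Seq c d) s t = (exists2 u, sem c s u & sem d u t).
Proof. by []. Qed.

(** Semantic laws are equations between propositions, so that programs can be evaluated by
    rewriting. *)
Lemma sem_succ r s t : 1 < r -> sem (Succ r) s t = (t = put s r (s r).+1).
Proof.
move=> r_gt1; apply/propext; split=> /= [[[_ ->]|[_ ->]] //|->].
by rewrite r_gt1; case: (0 < s r); [right | left].
Qed.

Lemma while_dec0 r c s t : s r = 0 -> sem (While_dec r c) s t = (t = s).
Proof.
move=> r0; apply/propext; split=> [[u su [u0 ->]]|->]; last first.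
  by exists s; [exact: rtc_refl | split=> //=; rewrite r0].
by case: su => //= y u' [y' []]; rewrite r0.
Qed.

(** The star cannot stop while [r] is positive, since [Test r false] would then block; the loop is
    thus deterministic in its number of rounds. *)
Lemma while_decS r c s t n : s r = n.+1 ->
  sem (While_dec r c) s t =
  (exists2 u, sem c (put s r n) u & sem (While_dec r c) u t).
Proof.
move=> rS; apply/propext; split=> [[u su [u0 ->]]|[u su [u' uu' [u0 ->]]]].
  case: su u0 => [|y u']; rewrite /= ?rS // => -[y' [_ ->]] /=.
  by move=> yy' ? ?; exists y => //; exists u'.
exists u' => //; apply: rtc_step uu'; exists (effect (Dec r) s) => //=.
  by rewrite rS.
by rewrite rS.
Qed.

Lemma sem_clear r s t : sem (Clear r) s t = (t = put s r 0).
Proof.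
rewrite /Clear; elim: {s}(s r) {-2}s (erefl (s r)) t => [|n IHn] s rn t.
  by rewrite while_dec0 // -rn put_id.
rewrite (while_decS _ _ rn); apply/propext; split=> [[u [_ ->]]|->].
  by rewrite IHn /= ?put_eq // put_put.
by exists (put s r n) => //; rewrite IHn ?put_eq // put_put.
Qed.

Ltac store_eq :=
  apply/funext => ?; rewrite /put; repeat case: eqP; intros; subst; lia.

Lemma sem_move x y s t : x != y -> 1 < y ->
  sem (Move x y) s t = (t = put (put s x 0) y (s x + s y)).
Proof.
move=> xNy y_gt1; rewrite /Move.
elim: {s}(s x) {-2}s (erefl (s x)) t => [|n IHn] s xn t.
  rewrite while_dec0 // xn; congr (_ = _); store_eq.
rewrite (while_decS _ _ xn).
have E : put (put s x 0) y (s x + s y) =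
  put (put (put (put s x n) y (s y).+1) x 0) y (n + (s y).+1).
  by store_eq.
have y_neq : y != x by rewrite eq_sym.
apply/propext; split=> [[u]|->].
  rewrite sem_succ // (put_neq _ _ y_neq) => ->.
  by rewrite IHn ?(put_neq _ _ xNy) ?put_eq // => ->; rewrite E.
exists (put (put s x n) y (s y).+1).
  by rewrite sem_succ // (put_neq _ _ y_neq).
by rewrite IHn ?(put_neq _ _ xNy) ?put_eq // E.
Qed.

Lemma sem_copy x y s t : x < y -> 1 < x -> s y.+1 = 0 ->
  sem (Copy x y) s t = (t = put s y (s x + s y)).
Proof.
move=> lt_xy x_gt1 s0.
have loop u : sem (While_dec x (Seq (Succ y) (Succ y.+1))) s u =
    (u = put (put (put s x 0) y (s x + s y)) y.+1 (s x)).
  (* Adding the zero [s y.+1] gives a form that holds for every content of [y.+1], as the induction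
     requires. *)
  have E : put (put (put s x 0) y (s x + s y)) y.+1 (s x) =
      put (put (put s x 0) y (s x + s y)) y.+1 (s x + s y.+1).
    by rewrite s0 addn0.
  rewrite E => {E s0}.
  elim: {s}(s x) {-2}s (erefl (s x)) u => [|n IHn] s xn u.
    rewrite while_dec0 // xn; congr (_ = _); store_eq.
  rewrite (while_decS _ _ xn).
  set s' := put (put (put s x n) y (s y).+1) y.+1 (s y.+1).+1.
  have s'x : s' x = n by rewrite /s' /put; repeat case: eqP => //; lia.
  have E : put (put (put s x 0) y (s x + s y)) y.+1 (s x + s y.+1) =
     put (put (put s' x 0) y (s' x + s' y)) y.+1 (s' x + s' y.+1).
    by rewrite xn s'x; clear s'x; rewrite /s'; store_eq.
  have body v : sem (Seq (Succ y) (Succ y.+1)) (put s x n) v = (v = s').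
    rewrite sem_seq; apply/propext; split=> [[w]|->].
      rewrite sem_succ ?sem_succ; try lia.
      move=> -> ->; clear s'x E; rewrite /s'; store_eq.
    exists (put (put s x n) y (s y).+1); rewrite sem_succ; try lia;
      clear s'x E; rewrite /s'; store_eq.
  apply/propext; split=> [[v]|->].
    by rewrite body => ->; rewrite IHn // -E.
  by exists s'; rewrite ?body // IHn // -E.
rewrite sem_seq; apply/propext; split=> [[u]|->].
  rewrite loop sem_move; try lia.
  move=> -> ->; store_eq.
eexists; first by rewrite loop.
rewrite sem_move; try lia; store_eq.
Qed.

(** * Compilation of recursive functions *)

Definition Seqs (cs : seq cmd) := foldr Seq (Op Nop) cs.

Lemma sem_seqs c cs s t :
  sem (Seqs (c :: cs)) s t = (exists2 u, sem c s u & sem (Seqs cs) u t).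
Proof. by []. Qed.

(* The value is stored in [y]; the registers beyond [y] serve as scratch space,
   are assumed to be 0, and are reset to 0. *)
Fixpoint compile n (f : recfun n) : n.-tuple nat -> nat -> cmd :=
  match f in recfun n return n.-tuple nat -> nat -> cmd with
  | RZero => fun _ _ => Op Nop
  | RSucc => fun xs y => Seq (Copy (thead xs) y) (Succ y)
  | RProj _ i => fun xs y => Copy (tnth xs i) y
  | RComp m _ f g => fun xs y =>
      Seq (Seqs [seq compile (g j) xs (y.+1 + j) | j <- enum 'I_m])
     (Seq (compile f [tuple y.+1 + j | j < m] (y.+1 + m))
     (Seq (Move (y.+1 + m) y)
          (Seqs [seq Clear (y.+1 + j) | j <- iota 0 m])))
  | RPrec _ f g => fun xs y =>
      Seq (compile f (behead_tuple xs) y)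
     (Seq (Copy (thead xs) y.+1)
     (Seq (While_dec y.+1
            (Seq (compile g [tuple of y.+2 :: y :: behead_tuple xs] y.+3)
            (Seq (Clear y)
            (Seq (Move y.+3 y) (Succ y.+2)))))
          (Clear y.+2)))
  | RMu _ f => fun xs y =>
      let eval := compile f [tuple of y :: xs] y.+1 in
      Seq (Star (Seq eval (Seq (Op (Dec y.+1)) (Seq (Clear y.+1) (Succ y)))))
     (Seq eval (Op (Test y.+1 false)))
  end.

Definition blank (s : store) y := forall r, y <= r -> s r = 0.

(** An equality: where [f] is undefined, no run terminates. Arguments lie above 1 because [Copy]
    rebuilds its source by increments, which the input registers refuse. *)
Definition compiled n (f : recfun n) := forall xs y s t,
  (forall x, x \in val xs -> 1 < x < y) -> 1 < y -> blank s y ->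
  sem (compile f xs y) s t =
  (exists2 v, rec_eval f (map_tuple s xs) v & t = put s y v).

Lemma sem_seqs_clear y m s t : blank s (y + m) ->
  sem (Seqs [seq Clear (y + j) | j <- iota 0 m]) s t =
  (t = fun r => if r < y then s r else 0).
Proof.
move=> s0.
(* This form of blankness refers to the list of cleared registers and so passes through an induction
   on it. *)
have {s0} : forall r, y <= r -> r \notin [seq y + j | j <- iota 0 m] -> s r = 0.
  move=> r le_yr; case: (ltnP r (y + m)) => [lt_r|le_r _]; last exact: s0.
  case/negP; apply/mapP; exists (r - y); rewrite ?mem_iota; lia.
elim: (iota 0 m) s t => [|j js IHj] s t s0.
  apply/propext; split=> [[_ ->]|->]; last split=> //; apply/funext => r /=;
  case: ltnP => // le_yr; rewrite s0 //.
have blank_upd r : y <= r -> r \notin [seq y + i | i <- js] ->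
    put s (y + j) 0 r = 0.
  move=> le_yr r_js; rewrite /put; case: eqP => // /eqP r_j.
  by rewrite s0 //= inE negb_or r_j.
have E : (fun r => if r < y then put s (y + j) 0 r else 0) =
   (fun r => if r < y then s r else 0).
  by apply/funext => r; rewrite /put; case: eqP => // ->; case: ifP => //; lia.
rewrite map_cons sem_seqs; apply/propext; split=> [[u]|->].
  by rewrite sem_clear => ->; rewrite IHj // E.
by exists (put s (y + j) 0); rewrite ?sem_clear // IHj // E.
Qed.

Lemma compiled_zero : compiled RZero.
Proof.
move=> xs y s t _ _ s0; apply/propext; split=> [[_ ->]|[v -> ->]].
  by exists 0; rewrite // -(s0 _ (leqnn _)) put_id.
by split; rewrite // -(s0 _ (leqnn _)) put_id.
Qed.

Lemma compiled_succ : compiled RSucc.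
Proof.
move=> xs y s t xs_lt y1 s0.
have /xs_lt/andP[x1 xy] : thead xs \in val xs by apply: mem_tnth.
rewrite [compile _ _ _]/= sem_seq; apply/propext; split=> [[u]|[v]].
  rewrite sem_copy ?(s0 y.+1) // (s0 y) // addn0 sem_succ // => -> ->.
  rewrite put_eq put_put.
  by exists (s (thead xs)).+1; rewrite // [rec_eval _ _ _]/= /thead tnth_map.
rewrite [rec_eval _ _ _]/= => -> ->; rewrite /thead tnth_map.
exists (put s y (s (thead xs))).
  by rewrite sem_copy ?(s0 y.+1) // (s0 y) // addn0.
by rewrite sem_succ // put_eq put_put.
Qed.

Lemma compiled_proj n (i : 'I_n) : compiled (RProj i).
Proof.
move=> xs y s t xs_lt y1 s0.
have /xs_lt/andP[x1 xy] : tnth xs i \in val xs by apply: mem_tnth.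
rewrite [compile _ _ _]/= sem_copy ?(s0 y.+1) // (s0 y) // addn0.
apply/propext; split=> [->|[v -> ->]]; last by rewrite tnth_map.
by exists (s (tnth xs i)) => //=; rewrite tnth_map.
Qed.

(** The store in the middle of a composition, when the inner functions computed so far have left the
    values [ws] above [y]. *)
Definition extend (s : store) y (ws : seq nat) : store :=
  fun r => if y < r then nth 0 ws (r - y.+1) else s r.

Lemma extend_rcons s y ws v :
  put (extend s y ws) (y.+1 + size ws) v = extend s y (rcons ws v).
Proof.
apply/funext => r; rewrite /put /extend nth_rcons.
case: (r =P y.+1 + size ws) => [->|r_neq].
  by rewrite addSn ltnS leq_addr subSS addKn ltnn eqxx.
case: ifP => // lt_yr; case: ltnP => // le_r.
by case: eqP => [|_]; [lia | rewrite nth_default].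
Qed.

Lemma compiled_comp m n (f : recfun m) (g : 'I_m -> recfun n) :
  compiled f -> (forall j, compiled (g j)) -> compiled (RComp f g).
Proof.
move=> fP gP xs y s t xs_lt y1 s0; rewrite [compile _ _ _]/=.
have map_extend ws : map_tuple (extend s y ws) xs = map_tuple s xs.
  apply/val_inj/eq_in_map => x /xs_lt/andP[_ lt_xy].
  by rewrite /extend ltnNge ltnW.
have blank_extend ws r : y.+1 + size ws <= r -> extend s y ws r = 0.
  by move=> le_r; rewrite /extend ifT ?nth_default; lia.
(* [ws] holds the values already computed, [js] the indices that remain, and [F] collects the
   remaining values. *)
have args (js : seq 'I_m) ws u : uniq js ->
    map val js = iota (size ws) (size js) ->
  sem (Seqs [seq compile (g j) xs (y.+1 + j) | j <- js]) (extend s y ws) u =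
  (exists2 F : 'I_m -> nat, forall j, j \in js ->
     rec_eval (g j) (map_tuple s xs) (F j) &
     u = extend s y (ws ++ map F js)).
  elim: js ws u => [|j js IHj] ws u.
    move=> _ _; rewrite /=; apply/propext; split=> [[_ ->]|[_ _ ->]].
      by exists (fun=> 0); rewrite ?cats0.
    by rewrite cats0.
  move=> /andP[j_js js_uniq]; rewrite [map val _]/= => -[j_ws js_ws].
  rewrite map_cons sem_seqs j_ws.
  have gjP v : sem (compile (g j) xs (y.+1 + size ws)) (extend s y ws) v =
      (exists2 a, rec_eval (g j) (map_tuple s xs) a &
         v = extend s y (rcons ws a)).
    rewrite gP; first 1 last.
    - by move=> x /xs_lt; lia.
    - lia.
    - exact: blank_extend.
    rewrite map_extend; apply/propext.
    by split=> -[a ga ->]; exists a; rewrite ?extend_rcons.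
  apply/propext; split=> [[v]|[F FP ->]].
    rewrite gjP => -[a ga ->]; rewrite IHj ?size_rcons // => -[F FP ->].
    exists (fun i => if i == j then a else F i) => [i|].
      rewrite inE; case: eqP => [->|_] //=; exact: FP.
    rewrite /= eqxx cat_rcons; congr (extend _ _ (_ ++ _ :: _)).
    by apply/eq_in_map => i i_js; case: eqP i_js => // ->; rewrite (negPf j_js).
  exists (extend s y (rcons ws (F j))).
    by rewrite gjP; exists (F j) => //; apply: FP; rewrite inE eqxx.
  rewrite IHj ?size_rcons //; exists F; rewrite ?cat_rcons // => i i_js.
  by apply: FP; rewrite inE i_js orbT.
have s_ext : s = extend s y [::].
  by apply/funext => r; rewrite /extend nth_nil; case: ltnP => // /ltnW /s0.
have tl (F : 'I_m -> nat) u :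
   sem (Seq (compile f [tuple y.+1 + j | j < m] (y.+1 + m))
     (Seq (Move (y.+1 + m) y)
          (Seqs [seq Clear (y.+1 + j) | j <- iota 0 m])))
     (extend s y (map F (enum 'I_m))) u =
   (exists2 v, rec_eval f [tuple F j | j < m] v & u = put s y v).
  set e := extend _ _ _.
  have sz : size (map F (enum 'I_m)) = m by rewrite size_map -cardE card_ord.
  have eE : map_tuple e [tuple y.+1 + j | j < m] = [tuple F j | j < m].
    apply: eq_from_tnth => j; rewrite tnth_map !tnth_mktuple /e /extend.
    rewrite addSn ltnS leq_addr subSS addKn (nth_map j) -?cardE ?card_ord //.
    by rewrite nth_ord_enum.
  have fP' w : sem (compile f [tuple y.+1 + j | j < m] (y.+1 + m)) e w =
     (exists2 v, rec_eval f [tuple F j | j < m] v & w = put e (y.+1 + m) v).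
    rewrite fP ?eE //; first by move=> x /mapP[j _ ->]; have := ltn_ord j; lia.
      lia.
    by move=> r; rewrite -{1}sz; apply: blank_extend.
  have e0 : e y = 0 by rewrite /e /extend ltnn s0.
  have clr v w : sem (Seq (Move (y.+1 + m) y)
          (Seqs [seq Clear (y.+1 + j) | j <- iota 0 m]))
        (put e (y.+1 + m) v) w = (w = put s y v).
    have cl0 w' : sem (Seqs [seq Clear (y.+1 + j) | j <- iota 0 m])
       (put (put (put e (y.+1 + m) v) (y.+1 + m) 0) y v) w' = (w' = put s y v).
      rewrite sem_seqs_clear; last first.
        move=> r le_r; rewrite !(@put_neq _ y); try lia.
        rewrite /put; case: eqP => // /eqP r_neq.
        by apply: blank_extend; rewrite sz.
      congr (_ = _); apply/funext => r; rewrite /put /e /extend.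
      case: (ltnP r y.+1) => [lt_r|lt_yr].
        by rewrite (ltn_eqF (_ : r < y.+1 + m)) ?ltn_addr // ltnNge -ltnS lt_r.
      by rewrite gtn_eqF // s0 // ltnW.
    rewrite sem_seq; apply/propext; split=> [[w']|->].
      rewrite sem_move; try lia.
      rewrite put_eq put_neq ?e0 ?addn0; last by lia.
      by move=> ->; rewrite cl0.
    exists (put (put (put e (y.+1 + m) v) (y.+1 + m) 0) y v); last first.
      by rewrite cl0.
    by rewrite sem_move ?put_eq ?put_neq ?e0 ?addn0 //; lia.
  rewrite sem_seq; apply/propext; split=> [[w]|[v fv ->]].
    by rewrite fP' => -[v fv ->]; rewrite clr => ->; exists v.
  by exists (put e (y.+1 + m) v); [rewrite fP'; exists v | rewrite clr].
have enumP : map val (enum 'I_m) = iota (size (@nil nat)) (size (enum 'I_m)).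
  rewrite -cardE card_ord; exact: val_enum_ord.
rewrite sem_seq {1}s_ext; apply/propext; split=> [[u]|[v [w [gw fw]] ->]].
  rewrite args ?enum_uniq // => -[F FP ->]; rewrite tl => -[v fv ->].
  exists v => //; exists [tuple F j | j < m]; split=> // j.
  by rewrite tnth_mktuple; apply: FP; rewrite mem_enum.
exists (extend s y (map (tnth w) (enum 'I_m))).
  by rewrite args ?enum_uniq //; exists (tnth w) => // j _; apply: gw.
rewrite tl; exists v => //; congr (rec_eval _ _ _): fw.
by apply: eq_from_tnth => j; rewrite tnth_mktuple.
Qed.

Lemma compiled_prec n (f : recfun n) (g : recfun n.+2) :
  compiled f -> compiled g -> compiled (RPrec f g).
Proof.
move=> fP gP xs y s t xs_lt y1 s0.
have x0_in : thead xs \in val xs by apply: mem_tnth.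
have tl_lt x : x \in val (behead_tuple xs) -> 1 < x < y.
  by move=> /mem_behead; apply: xs_lt.
pose V := behead_tuple (map_tuple s xs).
have VE : map_tuple s (behead_tuple xs) = V.
  by apply/val_inj; rewrite /= behead_map.
pose It := fix iter k y := match k with
  | 0 => rec_eval f V y
  | k'.+1 => exists z, iter k' z /\ rec_eval g [tuple of k' :: z :: V] y
  end.
have evalE v : rec_eval (RPrec f g) (map_tuple s xs) v = It (s (thead xs)) v.
  by rewrite -[s (thead xs)](_ : thead (map_tuple s xs) = _) // /thead tnth_map.
(* State of the loop: the current value [z] in [y], the number [k] of remaining rounds in [y.+1],
   the number [i] of finished rounds in [y.+2]. *)
pose L i z k := put (put (put s y z) y.+1 k) y.+2 i.
have L_y i z k : L i z k y = z.
  by rewrite /L /put; repeat (case: eqP => ?) => //; lia.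
have L_y1 i z k : L i z k y.+1 = k.
  by rewrite /L /put; repeat (case: eqP => ?) => //; lia.
have L_y2 i z k : L i z k y.+2 = i by rewrite /L put_eq.
have L_far i z k r : y.+3 <= r -> L i z k r = 0.
  by move=> le_r; rewrite /L !put_neq ?s0 //; lia.
have L_xs i z k x : 1 < x < y -> L i z k x = s x.
  by move=> lt_x; rewrite /L !put_neq //; lia.
have body i z k u :
  sem (Seq (compile g [tuple of y.+2 :: y :: behead_tuple xs] y.+3)
      (Seq (Clear y) (Seq (Move y.+3 y) (Succ y.+2)))) (L i z k) u =
  (exists2 z', rec_eval g [tuple of i :: z :: V] z' & u = L i.+1 z' k).
  rewrite sem_seq.
  have gP' v :
     sem (compile g [tuple of y.+2 :: y :: behead_tuple xs] y.+3) (L i z k) v =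
     (exists2 z', rec_eval g [tuple of i :: z :: V] z' &
        v = put (L i z k) y.+3 z').
    rewrite gP.
    - have -> // : map_tuple (L i z k) [tuple of y.+2 :: y :: behead_tuple xs]
                 = [tuple of i :: z :: V].
      apply/val_inj; rewrite /= L_y L_y2 behead_map; congr [:: _, _ & _].
      by apply/eq_in_map => x /tl_lt/L_xs.
    - by move=> x; rewrite !inE => /orP[/eqP ->|/orP[/eqP ->|/tl_lt]]; lia.
    - lia.
    - by move=> r; apply: L_far.
  have rest z' v : sem (Seq (Clear y) (Seq (Move y.+3 y) (Succ y.+2)))
      (put (L i z k) y.+3 z') v = (v = L i.+1 z' k).
    have y3y : y.+3 != y by lia.
    have E : put (put (put (put (put (L i z k) y.+3 z') y 0) y.+3 0) y z')
               y.+2 i.+1 = L i.+1 z' k.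
      apply/funext => r; rewrite /L /put; repeat (case: eqP => ?); try lia.
      by rewrite s0 //; lia.
    have w2 : put (put (put (L i z k) y.+3 z') y 0) y.+3 0 y = 0.
      by rewrite put_neq ?put_eq //; lia.
    have w3 : put (put (L i z k) y.+3 z') y 0 y.+3 = z'.
      by rewrite put_neq ?put_eq //; lia.
    have w4 : put (put (put (put (L i z k) y.+3 z') y 0) y.+3 0) y z' y.+2 = i.
      by rewrite !put_neq ?L_y2 //; lia.
    rewrite sem_seq; apply/propext; split=> [[w]|->].
      rewrite sem_clear => ->; rewrite sem_seq => -[w'].
      by rewrite sem_move ?w3 ?put_eq ?addn0 // => ->; rewrite sem_succ // w4 E.
    eexists; first by rewrite sem_clear.
    rewrite sem_seq; eexists; first by rewrite sem_move ?w3 ?put_eq ?addn0.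
    by rewrite sem_succ // w4 E.
  apply/propext; split=> [[v]|[z' gz' ->]].
    by rewrite gP' => -[z' gz' ->]; rewrite rest => ->; exists z'.
  by exists (put (L i z k) y.+3 z'); rewrite ?rest // gP'; exists z'.
rewrite [compile _ _ _]/= sem_seq.
set W := While_dec y.+1 _.
have loop0 i z u : sem W (L i z 0) u = (u = L i z 0).
  by rewrite /W while_dec0 ?L_y1.
have L_dec i z k k' : put (L i z k) y.+1 k' = L i z k'.
  by rewrite /L; store_eq.
have loopS i z k u : sem W (L i z k.+1) u =
    (exists2 z', rec_eval g [tuple of i :: z :: V] z' & sem W (L i.+1 z' k) u).
  rewrite /W (@while_decS _ _ _ _ k) ?L_y1 // L_dec.
  apply/propext; split=> [[v]|[z' gz' Wu]].
    by rewrite body => -[z' gz' ->]; exists z'.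
  by exists (L i.+1 z' k) => //; rewrite body; exists z'.
have loop_sound i z k u : It i z -> sem W (L i z k) u ->
    exists2 v, It (i + k) v & u = L (i + k) v 0.
  elim: k i z => [|k IHk] i z iz.
    by rewrite loop0 addn0 => ->; exists z.
  rewrite loopS => -[z' gz' /IHk]; rewrite -addSnnS; apply.
  by exists z.
(* Unrolls the iteration from round [i] back to round 0; each unfolding of [It] supplies the
   preceding value. *)
have loop_complete i v k u : It i v -> sem W (L i v k) u ->
    exists2 z, rec_eval f V z & sem W (L 0 z (i + k)) u.
  elim: i v k => [|i IHi] v k; first by exists v.
  move=> [z [iz gz]] Wu; rewrite addSnnS; apply: (IHi z) => //.
  by rewrite loopS; exists v.
have fP' u : sem (compile f (behead_tuple xs) y) s u =
    (exists2 z, rec_eval f V z & u = put s y z) by rewrite fP ?VE.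
have copyP z u : sem (Copy (thead xs) y.+1) (put s y z) u =
    (u = L 0 z (s (thead xs))).
  have := xs_lt _ x0_in => /andP[x1 xy].
  have w1 : put s y z (thead xs) = s (thead xs) by rewrite put_neq //; lia.
  have w2 r : y < r -> put s y z r = 0 by move=> ?; rewrite put_neq ?s0 //; lia.
  rewrite sem_copy ?w1 ?w2 //; try lia; rewrite addn0.
  congr (_ = _); apply/funext => r; rewrite /L /put.
  by repeat (case: eqP => ?) => //; try lia; rewrite s0; lia.
have clearP v k : put (L k v 0) y.+2 0 = put s y v.
  apply/funext => r; rewrite /L /put; repeat (case: eqP => ?) => //; try lia.
  - by rewrite s0; lia.
  - by rewrite s0; lia.
apply/propext; split=> [[u]|[v]].
  rewrite fP' => -[z fz ->]; rewrite sem_seq => -[u1]; rewrite copyP => ->.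
  rewrite sem_seq => -[u2 /(loop_sound 0 z _ _ fz) [v Iv ->]].
  by rewrite sem_clear clearP => ->; exists v; rewrite ?evalE.
rewrite evalE => Iv ->.
have [|z fz Wz] := @loop_complete _ v 0 (L (s (thead xs)) v 0) Iv.
  by rewrite loop0.
exists (put s y z); first by rewrite fP'; exists z.
rewrite sem_seq; exists (L 0 z (s (thead xs))); first by rewrite copyP.
rewrite sem_seq; exists (L (s (thead xs)) v 0); first by rewrite addn0 in Wz.
by rewrite sem_clear clearP.
Qed.

(** A round of the star decrements the value of [f] and so needs it positive, while the final test
    needs it zero: a run can only stop at the least zero. *)
Lemma compiled_mu n (f : recfun n.+1) : compiled f -> compiled (RMu f).
Proof.
move=> fP xs y s t xs_lt y1 s0.
set V := map_tuple s xs.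
pose L k := put s y k.
have L_y k : L k y = k by rewrite /L put_eq.
have evalP k u : sem (compile f [tuple of y :: xs] y.+1) (L k) u =
    (exists2 z, rec_eval f [tuple of k :: V] z & u = put (L k) y.+1 z).
  rewrite fP.
  - have -> // : map_tuple (L k) [tuple of y :: xs] = [tuple of k :: V].
    apply/val_inj; rewrite /= L_y; congr (_ :: _).
    by apply/eq_in_map => x /xs_lt lt_x; rewrite /L put_neq //; lia.
  - by move=> x; rewrite inE => /orP[/eqP ->|/xs_lt]; lia.
  - lia.
  - by move=> r lt_r; rewrite /L put_neq ?s0 //; lia.
rewrite [compile _ _ _]/= sem_seq.
set eval := compile f _ _; set body := Seq eval _.
have bodyP k u : sem body (L k) u =
    (exists2 z, rec_eval f [tuple of k :: V] z.+1 & u = L k.+1).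
  have rest z w : sem (Seq (Clear y.+1) (Succ y))
      (put (put (L k) y.+1 z.+1) y.+1 z) w = (w = L k.+1).
    have E : put (put (put (put (L k) y.+1 z.+1) y.+1 z) y.+1 0) y k.+1 =
        L k.+1.
      apply/funext => r; rewrite /L /put; repeat (case: eqP => ?) => //.
      by rewrite s0 //; lia.
    have w1 : put (put (put (L k) y.+1 z.+1) y.+1 z) y.+1 0 y = k.
      by rewrite !put_neq ?L_y //; lia.
    rewrite sem_seq; apply/propext; split=> [[v]|->].
      by rewrite sem_clear => ->; rewrite sem_succ // w1 E.
    by eexists; first (by rewrite sem_clear); rewrite sem_succ // w1 E.
  rewrite /body sem_seq; apply/propext; split=> [[v]|[z fz ->]].
    rewrite evalP => -[[|z] fz ->]; rewrite sem_seq => -[w [w1 ->]].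
      by rewrite /= put_eq in w1.
    by rewrite [effect _ _]/= put_eq rest => ->; exists z.
  exists (put (L k) y.+1 z.+1); first by rewrite evalP; exists z.+1.
  rewrite sem_seq; exists (effect (Dec y.+1) (put (L k) y.+1 z.+1)).
    by split; rewrite //= put_eq.
  by rewrite [effect _ _]/= put_eq rest.
have star_sound v u : rtc (sem body) v u -> forall k, v = L k ->
    exists2 k', u = L k' &
      forall i, k <= i < k' -> exists z, rec_eval f [tuple of i :: V] z.+1.
  elim=> {v u} [v|v w u vw _ IH] k vk.
    by exists k => // i; lia.
  move: vw; rewrite vk bodyP => -[z fz wk]; have [k' -> k'P] := IH _ wk.
  exists k' => // i /andP[]; rewrite leq_eqVlt => /orP[/eqP <- _|ki ik'].
    by exists z.
  by apply: k'P; rewrite ki.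
have star_complete k :
    (forall i, i < k -> exists z, rec_eval f [tuple of i :: V] z.+1) ->
    rtc (sem body) (L 0) (L k).
  elim: k => [|k IHk] kP; first exact: rtc_refl.
  apply: rtc_trans (IHk _) _ => [i ik|]; first by apply: kP; rewrite ltnS ltnW.
  have [z fz] := kP k (ltnSn k); apply: rtc_step (rtc_refl _ _).
  by rewrite bodyP; exists z.
have sL : s = L 0 by rewrite /L -(s0 y) // put_id.
have L_put k : put (L k) y.+1 0 = L k.
  apply/funext => r; rewrite /L /put.
  by repeat (case: eqP => ?) => //; try lia; rewrite s0; lia.
rewrite {1}sL; apply/propext.
split=> [[u /star_sound/(_ 0 erefl)[k -> kP]]|[k [fk kP] ->]].
  rewrite sem_seq => -[w]; rewrite evalP => -[[|z] fz ->] [/= w0 ->].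
    by exists k; rewrite ?L_put //; split=> // i ik; apply: kP.
  by rewrite put_eq in w0.
exists (L k); first exact: star_complete.
rewrite sem_seq; exists (L k); first by rewrite evalP; exists 0; rewrite ?L_put.
by split; rewrite //= /L put_neq ?s0 //; lia.
Qed.

Lemma compileP n (f : recfun n) : compiled f.
Proof.
elim: f => {n} [||n i|m n f fP g gP|n f fP g gP|n f fP].
- exact: compiled_zero.
- exact: compiled_succ.
- exact: compiled_proj.
- exact: compiled_comp.
- exact: compiled_prec.
- exact: compiled_mu.
Qed.

(** * Counter machines *)

(** The control state is the stack of commands still to be executed. *)
Definition next (k : seq cmd) : seq (op * seq cmd) :=
  match k with
  | [::] => [::]
  | Op o :: k => [:: (o, k)]
  | Seq c d :: k => [:: (Nop, [:: c, d & k])]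
  | Alt c d :: k => [:: (Nop, c :: k); (Nop, d :: k)]
  | Star c :: k => [:: (Nop, k); (Nop, [:: c, Star c & k])]
  end.

Definition cont_step (x y : seq cmd * store) : Prop :=
  exists o, [/\ (o, y.1) \in next x.1, guard o x.2 & y.2 = effect o x.2].

Lemma sem_cont c k s t : sem c s t -> rtc cont_step (c :: k, s) (k, t).
Proof.
elim: c k s t => [o|c IHc d IHd|c IHc d IHd|c IHc] k s t /=.
- move=> [gs ->]; apply: rtc_step (rtc_refl _ _); exists o.
  by rewrite inE.
- move=> [u su ut]; apply: (@rtc_step _ _ _ ([:: c, d & k], s)).
    by exists Nop; rewrite inE.
  exact: rtc_trans (IHc _ _ _ su) (IHd _ _ _ ut).
- case=> [st|st].
    by apply: rtc_step (IHc k _ _ st); exists Nop; rewrite inE eqxx.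
  by apply: rtc_step (IHd k _ _ st); exists Nop; rewrite !inE eqxx orbT.
- elim=> {s t} [s|s u t su _ IH].
    by apply: rtc_step (rtc_refl _ _); exists Nop; rewrite inE eqxx.
  apply: rtc_step (rtc_trans (IHc _ _ _ su) IH).
  by exists Nop; rewrite !inE eqxx orbT.
Qed.

Lemma cont_sem x y :
  rtc cont_step x y -> y.1 = [::] -> sem (Seqs x.1) x.2 y.2.
Proof.
elim=> {x y} [x ->|[k s] [k1 s1] y [o [/= + + ->]] _ IH y0]; first by split.
have {IH}/= st := IH y0; case: k => [|[o'|c d|c d|c] k] //=; rewrite !inE.
- by move=> /eqP[oE kE] gs; subst; exists (effect o' s).
- move=> /eqP[oE kE] _; subst; case: st => u su [v uv vt].
  by exists v => //; exists u.
- move=> /orP[] /eqP[oE kE] _; subst; case: st => u su ut; exists u => //.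
    by left.
  by right.
- move=> /orP[] /eqP[oE kE] _; subst; first by exists s => //; exact: rtc_refl.
  by case: st => u su [v uv vt]; exists v => //; apply: rtc_step uv.
Qed.

(** Finitely many stacks occur: the body of a star always runs on top of the same [Star c :: k], so
    loops create no new ones. The final [k] is added separately. *)
Fixpoint conts (c : cmd) (k : seq cmd) : seq (seq cmd) :=
  (c :: k) :: match c with
  | Op _ => [::]
  | Seq c d => conts c (d :: k) ++ conts d k
  | Alt c d => conts c k ++ conts d k
  | Star c => conts c (Star c :: k)
  end.

Lemma mem_conts c k : c :: k \in conts c k.
Proof. by case: c => *; rewrite inE eqxx. Qed.

Lemma conts_closed c k k1 x :
  k1 \in conts c k -> x \in next k1 -> x.2 \in k :: conts c k.
Proof.
elim: c k => [o|c IHc d IHd|c IHc d IHd|c IHc] k; rewrite [conts _ _]/= inE.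
- move=> /eqP ->; rewrite !inE => /eqP ->.
  by rewrite eqxx.
- case/orP=> [/eqP ->|]; rewrite ?mem_cat.
    by rewrite !inE => /eqP ->; rewrite mem_cat mem_conts !orbT.
  case/orP=> [/IHc/[apply]|/IHd/[apply]]; rewrite !inE mem_cat.
    by case/orP=> [/eqP ->|->]; rewrite ?mem_conts !orbT.
  by case/orP=> ->; rewrite ?orbT.
- case/orP=> [/eqP ->|]; rewrite ?mem_cat.
    by rewrite !inE mem_cat => /orP[]/eqP ->; rewrite mem_conts !orbT.
  case/orP=> [/IHc/[apply]|/IHd/[apply]]; rewrite !inE mem_cat;
  by case/orP=> ->; rewrite ?orbT.
- case/orP=> [/eqP ->|].
    by rewrite !inE => /orP[]/eqP ->; rewrite ?eqxx ?mem_conts ?orbT.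
  by move=> /IHc/[apply]; rewrite !inE; case/orP=> ->; rewrite ?orbT.
Qed.

Definition machine_step (ts : seq (nat * op * nat)) (x y : nat * store) :
    Prop :=
  exists o, [/\ (x.1, o, y.1) \in ts, guard o x.2 & y.2 = effect o x.2].

(** The empty stack comes first and [[:: c]] second, so that halting has label 0 and the start has
    label 1. *)
Definition states c := [::] :: conts c [::].

Definition label c k := index k (states c).
Arguments label : simpl never.

Definition transitions c : seq (nat * op * nat) :=
  [seq (label c k, x.1, label c x.2) |
     k <- states c, x <- next k].

Lemma transitions_bound c q o q' : (q, o, q') \in transitions c ->
  q < size (states c) /\ q' < size (states c).
Proof.
move=> /allpairsPdep[k [x [k_in x_in [-> _ ->]]]].
rewrite !index_mem; split=> //.
case: (predU1P k_in) => [k0|k_in']; first by rewrite k0 in x_in.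
exact: conts_closed x_in.
Qed.

Lemma machineP c s :
  (exists t, rtc (machine_step (transitions c)) (1, s) (0, t)) <->
  (exists t, sem c s t).
Proof.
have c_in : [:: c] \in states c by rewrite inE mem_conts orbT.
have ix1 : label c [:: c] = 1.
  by rewrite /label /states; case: (c) => *; rewrite /= eqxx.
have ix0 : label c [::] = 0 by [].
have label_inj k k' : k \in states c -> k' \in states c ->
  label c k = label c k' -> k = k' by apply: index_inj.
have next_in k x : k \in states c -> x \in next k -> x.2 \in states c.
  by case/predU1P => [-> //|]; apply: conts_closed.
have to_cont x y : rtc (machine_step (transitions c)) x y ->
    forall k, k \in states c -> x.1 = label c k -> y.1 = 0 ->
    rtc cont_step (k, x.2) ([::], y.2).
  elim=> {x y} [x|x y z [o [+ gx yE]] _ IH] k k_in xk z0.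
    rewrite (label_inj k [::]) -?xk //; exact: rtc_refl.
  move=> /allpairsPdep[k1 [x1 [k1_in x1_in [xk1 oE y1]]]].
  have kE : k = k1 by apply: label_inj => //; rewrite -xk -xk1.
  have := IH _ (next_in _ _ k1_in x1_in) y1 z0.
  apply: rtc_step; exists x1.1; rewrite -oE kE; split=> //=.
  by rewrite oE -surjective_pairing.
have of_cont x y : rtc cont_step x y -> x.1 \in states c ->
    rtc (machine_step (transitions c))
      (label c x.1, x.2) (label c y.1, y.2).
  elim=> {x y} [x|x y z [o [xy gx yE]] _ IH] x_in; first exact: rtc_refl.
  apply: rtc_step (IH (next_in _ _ x_in xy)); exists o; split=> //.
  by apply/allpairsPdep; exists x.1, (o, y.1).
split=> -[t st].
  have := cont_sem (to_cont _ _ st _ c_in (esym ix1) erefl) erefl.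
  by case=> u su _; exists u.
by exists t; have := of_cont _ _ (sem_cont [::] st) c_in; rewrite ix1 ix0.
Qed.

(** * The attention actions of a machine *)

(** The attention of [Inp false] and [Inp true] holds registers 0 and 1, the attention of [Lab] is
    the label of a world, and the accessibility of [Rel] links the chains. *)
Inductive agt := Inp (b : bool) | Lab | Rel.

Definition agt_enc a :=
  match a with Inp b => Some (Some b) | Lab => Some None | Rel => None end.

Definition agt_dec x :=
  match x with Some (Some b) => Inp b | Some None => Lab | None => Rel end.

Lemma agt_encK : cancel agt_enc agt_dec. Proof. by case. Qed.

HB.instance Definition _ := Finite.copy agt (can_type agt_encK).

Inductive evt := ESeed | ECtl | EKeep | EMine | EAux.

Definition evt_enc e : 'I_5 :=
  match e with
  | ESeed => inord 0 | ECtl => inord 1 | EKeep => inord 2 | EMine => inord 3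
  | EAux => inord 4
  end.

Definition evt_dec (i : 'I_5) :=
  match val i with
  | 0 => ESeed | 1 => ECtl | 2 => EKeep | 3 => EMine | _ => EAux
  end.

Lemma evt_encK : cancel evt_enc evt_dec.
Proof. by case; rewrite /evt_dec /= inordK. Qed.

HB.instance Definition _ := Finite.copy evt (can_type evt_encK).

(* A state of the planning task consists of: a seed world, which is the actual
   world and has the label [top]; a control world, whose label is the state of
   the machine; and, for every register, a chain of worlds whose number is the
   value of the register.  In the chain of [j], the world which is furthest from
   the seed has the label [front j], the others have the label [live j].  Labels
   are attention values of [Lab] and thus can only decrease, which suffices
   because new worlds are copies of the seed. *)
Section Task.
Variables (Phi : countType) (S J N : nat).

Local Notation fm := (form Phi agt N).

(** Labels below [S] are machine states. [live j] is one more than [front j], so that a live world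
    becomes the front at cost 1. *)
Definition front j := S + 2 * j.
Definition live j := (S + 2 * j).+1.
Definition top := S + 2 * J.

Definition Bot : fm := Neg Top.
Definition has_label k : fm := At (AttEq Phi Lab (inord k)).
Definition below k : fm := At (AttLt Phi Lab (inord k)).
Definition Dia i (f : fm) : fm := Neg (Know i (Neg f)).
(* The relation of [Inp false] is total. *)
Definition Somewhere (f : fm) : fm := Dia (Inp false) f.

Definition positive j : fm :=
  if j < 2 then Neg (At (AttEq Phi (Inp (j == 1)) (inord 0)))
  else Somewhere (has_label (front j)).
Definition in_chain : fm := And (Neg (below S)) (below top).
Definition of_chain j : fm :=
  Neg (And (Neg (has_label (front j))) (Neg (has_label (live j)))).
Definition second j : fm :=
  And (has_label (live j)) (Dia Rel (has_label (front j))).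

Definition guard_form o : fm :=
  match o with
  | Nop => Top
  | Inc j b => if j < 2 then Bot else if b then positive j else Neg (positive j)
  | Dec j => positive j
  | Test j b => if b then positive j else Neg (positive j)
  end.

(* [ECtl] creates the new control world, while the old one satisfies no
   precondition.  [EAux] creates the new end of a chain in an increment, and
   turns the second world of a chain into the front in a decrement. *)
Definition tr_pre (t : nat * op * nat) (e : evt) : fm :=
  let: (q, o, q') := t in
  match e with
  | ESeed => And (And (has_label top) (Somewhere (has_label q))) (guard_form o)
  | ECtl => has_label top
  | EKeep => And in_chain
      match o with
      | Inc j _ => Neg (of_chain j)
      | Dec j => And (Neg (has_label (front j))) (Neg (second j))
      | _ => Top
      end
  | EMine => match o with Inc j _ => of_chain j | _ => Bot end
  | EAux => match o with
            | Inc _ _ => has_label top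
            | Dec j => second j
            | _ => Bot
            end
  end.

(** A copy of the seed, whose label is [top], gets the label k by paying [top - k]. A decrement of
    register 0 or 1 is the payment of one unit by the corresponding [Inp]. *)
Definition tr_cost (t : nat * op * nat) (i : agt) (e : evt) : nat :=
  let: (q, o, q') := t in
  match i with
  | Inp b => if o is Dec j then (j == b :> nat : nat) else 0
  | Lab => match e with
           | ECtl => top - q'
           | EAux => match o with
                     | Inc j b => top - (front j + b)
                     | _ => 1
                     end
           | _ => 0
           end
  | Rel => 0
  end.

Definition is_inc o := if o is Inc _ _ then true else false.

(* The classes of Q ([star = false]) and of Q^* ([star = true]).  The worlds of
   the chain of [r] take part in an increment of [r] through [EMine], those of
   the other chains through [EKeep].  Then the union of the relations for [Rel]
   is the path EMine - EAux - ESeed - EKeep: the end of the chain of [r] is cut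
   off the seed and linked to the new world, which is linked to the seed, and
   the ends of the other chains remain linked to the seed. *)
Definition evt_class (star : bool) (t : nat * op * nat) (i : agt) (e : evt) :
    nat :=
  match i with
  | Inp _ => 0
  | Lab => evt_enc e
  | Rel =>
      match e with
      | ECtl => 0
      | EMine => 1
      | EAux => if is_inc t.1.2 && star then 2 else 1
      | ESeed => if is_inc t.1.2 then 2 else 1
      | EKeep => if is_inc t.1.2 then if star then 3 else 2 else 1
      end
  end.

Definition tr_rel star t i : rel evt :=
  fun e e' => evt_class star t i e == evt_class star t i e'.

Lemma tr_rel_equiv star t i : equivalence_rel (tr_rel star t i).
Proof. by move=> x y z; split; rewrite /tr_rel // => /eqP ->. Qed.

Definition gen_cost t i (f : fm) e := if f is Top then 0 else tr_cost t i e.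

Lemma evt_gt0 : 0 < #|{: evt}|. Proof. by apply/card_gt0P; exists ESeed. Qed.

Lemma gen_cost_top t i e : gen_cost t i Top e = 0. Proof. by []. Qed.

(** Only the cost of [Lab] depends on the event, and the classes of [Lab] are singletons. *)
Lemma gen_cost_inv t i f e e' :
  tr_rel false t i e e' || tr_rel true t i e e' ->
  gen_cost t i f e = gen_cost t i f e'.
Proof.
rewrite /tr_rel orbC; case: t => -[q o] q'; case: i => //.
rewrite /= orbb => /eqP/ord_inj/(can_inj evt_encK) ->//.
Qed.

Definition tr_model t : action_model Phi agt N :=
  @ActionModel Phi agt N evt evt_gt0 (tr_rel false t) (tr_rel true t) (tr_pre t)
    (gen_cost t) (tr_rel_equiv false t) (tr_rel_equiv true t) (gen_cost_top t)
    (@gen_cost_inv t).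

(** Since [Top] is free, the agents who pay ask [Bot]. [Rel] asks [Top], which every precondition
    entails, so that all of $Q^*$ is kept. *)
Definition tr_question (i : agt) : fm := if i is Rel then Top else Bot.

Definition tr_action t : action Phi agt N :=
  @Action Phi agt N (tr_model t) tr_question ESeed.

End Task.

(** * Simulation *)

Definition op_bound J o :=
  match o with Nop => true | Inc j _ | Dec j | Test j _ => j < J end.

(** Names of worlds that remain stable under updates: an increment adds an index at the seed end,
    and a decrement moves the base [a j] up instead of renumbering. *)
Inductive node := NSeed | NCtl | NChain (j i : nat).

Section Nodes.
Variables (S J : nat).

Implicit Types (a s : store) (x y : node) (o : op) (e : evt).

(* The chain of register [j] consists of the nodes [NChain j i] with
   [a j <= i < a j + s j]; the last of them is adjacent to the seed. *)
Definition node_ok a s x :=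
  if x is NChain j i then (1 < j < J) && (a j <= i < a j + s j) else true.

Definition node_label a q x :=
  match x with
  | NSeed => top S J
  | NCtl => q
  | NChain j i => if i == a j then front S j else live S j
  end.

Definition adjacent a s x y :=
  match x, y with
  | NSeed, NSeed | NCtl, NCtl => true
  | NChain j i, NChain j' i' => [&& j == j', i <= i'.+1 & i' <= i.+1]
  | NChain j i, NSeed | NSeed, NChain j i => i.+1 == a j + s j
  | _, _ => false
  end.

(** The meaning of [tr_pre] on nodes, without the tests of state and guard in [ESeed], which amount
    to applicability. *)
Definition node_pre a o e x : bool :=
  match e, x with
  | ESeed, NSeed | ECtl, NSeed => true
  | EKeep, NChain j i =>
      match o with
      | Inc j' _ => j != j'
      | Dec j' => (j == j') ==> (a j + 1 < i)
      | _ => true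
      end
  | EMine, NChain j i => if o is Inc j' _ then j == j' else false
  | EAux, NSeed => is_inc o
  | EAux, NChain j i =>
      if o is Dec j' then (j == j') && (i == (a j).+1) else false
  | _, _ => false
  end.

Definition node_upd a s o e x :=
  match e with
  | ESeed => NSeed
  | ECtl => NCtl
  | EKeep | EMine => x
  | EAux => if o is Inc j _ then NChain j (a j + s j) else x
  end.

Definition base_upd a o : store := if o is Dec j then put a j (a j).+1 else a.

Lemma adjacent_upd a s q o q' e e' x y :
  node_ok a s x -> node_ok a s y -> guard o s ->
  node_pre a o e x -> node_pre a o e' y ->
  adjacent (base_upd a o) (effect o s)
    (node_upd a s o e x) (node_upd a s o e' y) =
  adjacent a s x y &&
  (tr_rel false (q, o, q') Rel e e' || tr_rel true (q, o, q') Rel e e').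
Proof.
rewrite /tr_rel.
case: e x => [] [||j i] //; case: e' y => [] [||j' i'] //;
case: o => [|r b|r|r b] //=; rewrite /put; repeat case: eqP; intros; subst; lia.
Qed.

Lemma node_ok_upd a s o e x :
  op_bound J o ->
  node_ok a s x -> guard o s -> node_pre a o e x ->
  node_ok (base_upd a o) (effect o s) (node_upd a s o e x).
Proof.
case: e x => [] [||j i] //; case: o => [|r b|r|r b] //=;
rewrite /put; repeat case: eqP; intros; subst; lia.
Qed.

Lemma node_label_upd a s q o q' e x :
  op_bound J o -> q' < S ->
  node_ok a s x -> guard o s -> node_pre a o e x ->
  node_label (base_upd a o) q' (node_upd a s o e x) =
  node_label a q x - tr_cost S J (q, o, q') Lab e.
Proof.
rewrite /top /front /live.
case: e x => [] [||j i] //; case: o => [|r b|r|r b] //=;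
rewrite /top /front /live /put; repeat case: eqP; intros; subst; lia.
Qed.

(** The seed is set apart because the precondition of [ESeed] also tests state and guard; its copy
    is the new actual world. *)
Lemma node_upd_onto a s o x :
  guard o s -> node_ok (base_upd a o) (effect o s) x ->
  x = NSeed \/ exists e y,
  [/\ e <> ESeed, node_ok a s y, node_pre a o e y & node_upd a s o e y = x].
Proof.
case: x => [_ _| _ _|j i]; [by left|by right; exists ECtl, NSeed|].
move=> gs /= x_ok; right.
case: o gs x_ok => [|r b|r|r b] /= gs x_ok.
- by exists EKeep, (NChain j i).
- case: (j =P r) => [jr|/eqP jr]; last first.
    by exists EKeep, (NChain j i); split=> //=; move: x_ok; rewrite put_neq.
  subst j; rewrite put_eq in x_ok.
  case: (i =P a r + s r) => [ir|ir].
    by exists EAux, NSeed; rewrite ir.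
  by exists EMine, (NChain r i); split=> //=; lia.
- case: (j =P r) => [jr|/eqP jr]; last first.
    exists EKeep, (NChain j i); split=> //=; move: x_ok; rewrite ?put_neq //.
    by rewrite (negPf jr).
  subst j; rewrite !put_eq in x_ok.
  case: (i =P (a r).+1) => [ir|ir].
    by exists EAux, (NChain r i); split=> //=; lia.
  by exists EKeep, (NChain r i); split=> //=; lia.
- by exists EKeep, (NChain j i).
Qed.

End Nodes.

(** * Attention states that represent machine configurations *)

Section Simulation.
Variables (Phi : countType) (S J N : nat).
Hypothesis topN : top S J <= N.

Local Notation fm := (form Phi agt N).
Local Notation action t := (@tr_action Phi S J N t).

(** [p] encodes the machine state [q] and the store [s]. Labels and links are read off from the
    image under [h], so that the formulas used can be evaluated on nodes. *)
Record represents (p : pointed Phi agt) (h : world (str_of p) -> node)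
    (a : store) q s : Prop := {
  rep_point : h (point p) = NSeed;
  rep_ok w : node_ok J a s (h w);
  rep_onto x : node_ok J a s x -> exists w, h w = x;
  rep_label w : @att _ _ (str_of p) Lab w = node_label S J a q (h w);
  rep_input (b : bool) w : @att _ _ (str_of p) (Inp b) w = s b;
  rep_all w v : @acc _ _ (str_of p) (Inp false) w v;
  rep_chain w v : @acc _ _ (str_of p) Rel w v = adjacent a s (h w) (h v)
}.

Section Sat.
Context (p : pointed Phi agt) (h : world (str_of p) -> node).
Context (a : store) (q : nat) (s : store).
Hypothesis rep : represents h a q s.
Hypothesis qS : q < S.
Implicit Types w : world (str_of p).

Lemma sat_label k w : k <= N ->
  sat w (has_label Phi N k) = (node_label S J a q (h w) == k).
Proof. by move=> kN; rewrite /= inordK // (rep_label rep). Qed.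

Lemma sat_dia i w (f : fm) : sat w (Dia i f) = [exists v, acc i w v && sat v f].
Proof.
by rewrite /= negb_forall; apply: eq_existsb => v; rewrite negb_imply negbK.
Qed.

Lemma sat_somewhere w k : k <= N ->
  sat w (Somewhere (has_label Phi N k)) <->
  exists2 x, node_ok J a s x & node_label S J a q x = k.
Proof.
move=> kN; rewrite /Somewhere sat_dia.
split=> [/existsP[v /andP[_]]|[x /(rep_onto rep)[v <-] xk]].
  by rewrite sat_label // => /eqP vk; exists (h v) => //; exact: rep_ok rep v.
by apply/existsP; exists v; rewrite (rep_all rep) sat_label // xk eqxx.
Qed.

(** All labels of the seed and of chains are at least [S], so only control worlds carry a label
    below [S]. *)
Lemma sat_control w k : k < S ->
  sat w (Somewhere (has_label Phi N k)) = (k == q).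
Proof.
move=> kS; have kN : k <= N by move: topN; rewrite /top; lia.
apply/idP/eqP=> [/(sat_somewhere _ kN)[x]|->]; last first.
  by apply/sat_somewhere; [move: topN; rewrite /top; lia | exists NCtl].
by case: x => [_|_|j i _] /=; rewrite /top /front /live; try case: eqP; lia.
Qed.

Lemma sat_front w j : 1 < j < J ->
  sat w (Somewhere (has_label Phi N (front S j))) = (0 < s j).
Proof.
move=> jJ; have kN : front S j <= N by move: topN; rewrite /top /front; lia.
apply/idP/idP=> [/(sat_somewhere _ kN)[[||j' i] /=]|sj].
- by rewrite /top /front; lia.
- by rewrite /front; lia.
- have [->|/eqP ji] := j =P j'; first by lia.
  by rewrite /front /live; case: eqP; lia.
- apply/sat_somewhere => //.
  by exists (NChain j (a j)) => /=; rewrite ?eqxx //; lia.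
Qed.

Lemma sat_positive w j : j < J -> sat w (positive Phi S N j) = (0 < s j).
Proof.
move=> jJ; rewrite /positive; case: ltnP => j2; last first.
  by apply: sat_front; rewrite j2.
rewrite /= inordK // (rep_input rep) lt0n; congr (s _ != _).
by case: j j2 {jJ} => [|[|]].
Qed.

Lemma sat_guard w o : op_bound J o -> sat w (guard_form Phi S N o) = guard o s.
Proof.
case: o => [|j b|j|j b] /= jJ //.
- rewrite ltnNge -ltnS; case: ltnP => //= _.
  by case: b; rewrite /= sat_positive //; case: (0 < s j).
- exact: sat_positive.
- by case: b; rewrite /= sat_positive //; case: (0 < s j).
Qed.

Lemma sat_in_chain w :
  sat w (in_chain Phi S J N) = if h w is NChain _ _ then true else false.
Proof.
have := rep_ok rep w; rewrite /= !inordK ?(rep_label rep) -?leqNgt;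
  try by move: topN; rewrite /top; lia.
by case: (h w) => [||j i]; rewrite /= /top /front /live; try case: eqP; lia.
Qed.

Lemma sat_of_chain w j : j < J ->
  sat w (of_chain Phi S N j) = if h w is NChain j' _ then j' == j else false.
Proof.
move=> jJ; have := rep_ok rep w.
rewrite [sat _ _]/= !inordK ?(rep_label rep);
  try by move: topN; rewrite /top /front /live; lia.
by case: (h w) => [||j' i]; rewrite /= /top /front /live;
  try case: (i == a j'); lia.
Qed.

(** Linked worlds of a chain differ by at most 1 in index, and only the index [a j] has the label
    [front j]. *)
Lemma sat_second w j : j < J ->
  sat w (second Phi S N j) =
  if h w is NChain j' i then (j' == j) && (i == (a j).+1) else false.
Proof.
move=> jJ.
have frontN : front S j <= N by move: topN; rewrite /top /front; lia.
have liveN : live S j <= N by move: topN; rewrite /top /live; lia.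
have -> : sat w (second Phi S N j) = sat w (has_label Phi N (live S j)) &&
    sat w (Dia Rel (has_label Phi N (front S j))) by [].
rewrite sat_label // sat_dia.
have := rep_ok rep w; case hw: (h w) => [||j' i] w_ok.
- by rewrite (_ : _ == _ = false) //= /top /live; lia.
- by rewrite (_ : _ == _ = false) //= /live; lia.
move: w_ok; rewrite [node_ok _ _ _ _]/= [node_label _ _ _ _ _]/= => w_ok.
apply/andP/andP=> [[lab_w /existsP[v /andP[wv]]]|[/eqP jE /eqP iE]].
  rewrite sat_label // => lab_v; rewrite (rep_chain rep) hw in wv; move: lab_v.
  have := rep_ok rep v; case: (h v) wv => [||j2 i2] /=; move: lab_w;
  rewrite /top /front /live; repeat case: eqP; intros; subst; try lia.
subst j' i; split; first by rewrite ifN //; lia.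
have [v hv] : exists v, h v = NChain j (a j).
  by apply: (rep_onto rep); rewrite /=; lia.
apply/existsP; exists v; rewrite (rep_chain rep) sat_label // hv hw /= !eqxx.
by rewrite !andbT; lia.
Qed.

Lemma sat_pre w q0 o q' e : q0 < S -> op_bound J o ->
  sat w (tr_pre Phi S J N (q0, o, q') e) =
  node_pre a o e (h w) && (if e is ESeed then (q0 == q) && guard o s else true).
Proof.
move=> q0S oJ.
have sat_top : sat w (has_label Phi N (top S J)) =
    if h w is NSeed then true else false.
  rewrite sat_label //; have := rep_ok rep w.
  by case: (h w) => [||j i]; rewrite /= /top /front /live;
    try case: (i == a j); lia.
have sat_And f g : sat w (And f g : fm) = sat w f && sat w g by [].
have sat_Neg f : sat w (Neg f : fm) = ~~ sat w f by [].
have frontN j : j < J -> front S j <= N by move: topN; rewrite /top /front; lia.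
have w_ok := rep_ok rep w.
case: e; rewrite [tr_pre _ _ _ _ _ _]/= ?andbT.
- by rewrite !sat_And sat_top sat_control // sat_guard // andbA; case: (h w).
- by rewrite sat_top; case: (h w).
- rewrite sat_And sat_in_chain.
  case: o oJ => [|j b|j|j b] jJ.
  + by case: (h w).
  + by rewrite sat_Neg sat_of_chain //; case: (h w).
  + rewrite sat_And !sat_Neg sat_second // sat_label ?frontN //.
    case: (h w) w_ok => [||j' i] //=; rewrite /front /live.
    by repeat case: eqP; intros; subst; lia.
  + by case: (h w).
- by case: o oJ => [|j b|j|j b] jJ; rewrite ?sat_of_chain //; case: (h w).
- case: o oJ => [|j b|j|j b] jJ; try by case: (h w).
    by rewrite sat_top; case: (h w).
  by rewrite sat_second //; case: (h w) => //= j' i; case: eqP => // ->.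
Qed.
End Sat.

(** The question [Top] of [Rel] costs nothing and is entailed by all preconditions, so splitting
    removes no pair. *)
Lemma upd_acc_chain (M : structure Phi agt) t x y :
  @upd_acc _ _ _ M (action t) Rel x y =
  @acc _ _ M Rel (val x).1 (val y).1 &&
  (tr_rel false t Rel (val x).2 (val y).2 ||
   tr_rel true t Rel (val x).2 (val y).2).
Proof.
rewrite /upd_acc; case: (val x) (val y) => [v e] [u e'] /=.
congr (_ && (_ || _)); rewrite /Qs_split /= andb_idr // => _.
by apply/asboolP; split.
Qed.

Lemma applicable_action p h a q s q0 o q' : represents (p := p) h a q s ->
  q < S -> q0 < S -> op_bound J o ->
  applicable p (action (q0, o, q')) <-> q0 = q /\ guard o s.
Proof.
move=> rep qS q0S oJ.
rewrite /applicable [sat _ _](sat_pre rep qS _ _ ESeed q0S oJ).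
rewrite (rep_point rep) /=; split=> [/andP[/eqP //]|[-> ->]].
by rewrite eqxx.
Qed.

Lemma represents_update p h a q s q0 o q'
    (app : applicable p (action (q0, o, q'))) :
  represents (p := p) h a q s -> q < S -> q0 < S -> q' < S -> op_bound J o ->
  exists h', represents (p := update app) h' (base_upd a o) q' (effect o s).
Proof.
move=> rep qS q0S q'S oJ.
have /(applicable_action q' rep qS q0S oJ)[q0E gs] := app.
pose h' (x : world (upd (str_of p) (action (q0, o, q')))) :=
  node_upd a s o (val x).2 (h (val x).1).
have pre_val (x : upd_world (str_of p) (action (q0, o, q'))) :
    node_pre a o (val x).2 (h (val x).1).
  case: x => -[w e] /= w_pre.
  move: (w_pre : sat w (tr_pre Phi S J N (q0, o, q') e)).
  by rewrite (sat_pre rep qS) // => /andP[].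
exists h'; split.
- by rewrite /h' /=.
- move=> x; apply: node_ok_upd => //; exact: (rep_ok rep).
- move=> x /(node_upd_onto gs)[->|[e [y [e_neq y_ok e_pre <-]]]].
    by exists (point (update app)); rewrite /h' /=.
  have [w hw] := rep_onto rep y_ok.
  have w_pre : sat w (tr_pre Phi S J N (q0, o, q') e).
    by rewrite (sat_pre rep qS) // hw e_pre; case: (e) e_neq.
  by exists (exist _ (w, e) w_pre); rewrite /h' /= hw.
- move=> x; rewrite (@node_label_upd S J a s q o q') //; last first.
    exact: (rep_ok rep).
  by rewrite /= (rep_label rep).
(* Inputs change by [Dec] only: the guard of [Inc] excludes registers 0 and 1. *)
- move=> b x; rewrite /= (rep_input rep).
  case: o oJ gs {app pre_val h' x} => [|j b' _|j _ _|j b' _] /=;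
    rewrite ?subn0 // /put.
    by move=> /andP[j_gt1 _]; case: eqP => // bj; case: b bj => /= bj; lia.
  by rewrite eq_sym; case: eqP => [->|_]; rewrite ?subn0 ?subn1.
- move=> x y /=; rewrite /upd_acc; case: (val x) (val y) => [v e] [u e'] /=.
  by rewrite (rep_all rep).
- move=> x y; rewrite [acc _ _ _]upd_acc_chain (rep_chain rep) /h'.
  by rewrite (@adjacent_upd J _ _ q0 _ q') //; exact: (rep_ok rep).
Qed.

End Simulation.

(** * The planning task of a machine *)

Lemma agt_gt0 : 0 < #|{: agt}|. Proof. by apply/card_gt0P; exists Lab. Qed.

Definition init_acc (i : agt) : rel bool :=
  if i is Inp _ then fun _ _ => true else fun w v => w == v.

(** The world [true] is the seed and [false] the control world, in machine state 1. [n0] is both the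
    label [top] of the seed and the first input. *)
Definition init_att (n0 n1 : nat) (i : agt) (w : bool) : nat :=
  match i with
  | Inp b => if b then n1 else n0
  | Lab => if w then n0 else 1
  | Rel => 0
  end.

Definition init_store (n0 n1 : nat) : store :=
  fun r => match r with 0 => n0 | 1 => n1 | _ => 0 end.

Section MachineTask.
Variables (Phi : countType) (S J : nat) (ts : seq (nat * op * nat)) (n : nat).
Hypothesis S_gt1 : 1 < S.
Hypothesis ts_bound : forall q o q', (q, o, q') \in ts ->
  [/\ q < S, q' < S & op_bound J o].

Let N := top S J + n.

Definition init_structure : structure Phi agt :=
  @Structure Phi agt bool init_acc (fun=> set0) (init_att (top S J) n).

Lemma init_structure_ok : attention_model N init_structure.
Proof.
have top_gt1 : 1 < top S J by rewrite /top; lia.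
split=> [|i|i w v|i w] /=.
- by rewrite card_bool.
- by case: i => [b||] x y z; split=> //= /eqP ->.
- by case: i => [b||] //= /eqP ->.
- by case: i => [[]||] /=; try case: w; rewrite /N; lia.
Qed.

Definition machine_task : task Phi :=
  @Task Phi agt agt_gt0 N
    (@Pointed Phi agt init_structure true) init_structure_ok
    (size ts) (fun k => tr_action Phi S J N (tnth (in_tuple ts) k))
    (Somewhere (has_label Phi N 0)).

Let topN : top S J <= N. Proof. exact: leq_addr. Qed.

Lemma represents_init :
  @represents Phi S J (init machine_task)
    (fun w : bool => if w then NSeed else NCtl) (fun=> 0)
    1 (init_store (top S J) n).
Proof.
split=> //.
- by case.
- by case=> [_|_|[|[|j]] i] /=; [exists true | exists false | lia..].
- by case.
- by case.
- by case=> -[].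
Qed.

Lemma plan_sound p h a q s (plan : seq 'I_(size ts)) p' :
  represents S J (p := p) h a q s -> q < S ->
  yields p [seq act (t := machine_task) k | k <- plan] p' ->
  sat (point p') (goal machine_task) ->
  exists t, rtc (machine_step ts) (q, s) (0, t).
Proof.
elim: plan p h a q s => [|k plan IHplan] p h a q s rep qS.
  move=> -> /idP; rewrite [sat _ _](sat_control topN rep qS); last by lia.
  by move=> /eqP <-; exists s; apply: rtc_refl.
case=> app; move: app; rewrite /machine_task /=.
have : tnth (in_tuple ts) k \in ts by apply: mem_tnth.
case: (tnth _ k) => -[q0 o] q' t_in app; have [q0S q'S oJ] := ts_bound t_in.
have [q0E gs] := (applicable_action topN q' rep qS q0S oJ).1 app.
have [h' rep'] := represents_update topN app rep qS q0S q'S oJ.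
move=> p'y /(IHplan _ _ _ _ _ rep' q'S p'y)[t st]; exists t.
by apply: rtc_step st; exists o; rewrite -q0E.
Qed.

Lemma plan_complete x y p h a :
  rtc (machine_step ts) x y -> y.1 = 0 ->
  represents S J (p := p) h a x.1 x.2 -> x.1 < S ->
  exists plan p', yields p [seq act (t := machine_task) k | k <- plan] p' /\
    sat (point p') (goal machine_task).
Proof.
move=> xy y0; elim: xy p h a y0
  => {x y} [x|x x' y [o [t_in gs x'E]] _ IH] p h a y0 rep qS.
  exists [::], p; split=> //; rewrite [sat _ _](sat_control topN rep qS) ?y0 //.
  by lia.
have [q0S q'S oJ] := ts_bound t_in.
have /tnthP[k kE] : (x.1, o, x'.1) \in in_tuple ts by [].
have app := (applicable_action topN x'.1 rep qS q0S oJ).2 (conj erefl gs).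
have [h' rep'] := represents_update topN app rep qS q0S q'S oJ.
rewrite -x'E in rep'.
have [plan [p' [py p'goal]]] := IH _ _ _ y0 rep' q'S.
exists (k :: plan), p'; split=> //=; rewrite -[tnth _ _]kE.
by exists app.
Qed.

Lemma machine_task_solution :
  has_solution machine_task <->
  exists t, rtc (machine_step ts) (1, init_store (top S J) n) (0, t).
Proof.
split=> [[plan [p' [py p'goal]]]|[t st]].
  exact: plan_sound represents_init S_gt1 py p'goal.
have [plan [p' py]] := plan_complete st erefl represents_init S_gt1.
by exists plan, p'.
Qed.

(** The bound [top S J] replaces [N], which depends on [n]; so [n] can be chosen as the code of this
    list without circularity. *)
Definition machine_data : seq _ :=
  [seq action_data (tr_action Phi S J (top S J) (tnth (in_tuple ts) k)) |
     k : 'I_(size ts)].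

(** Attention atoms enter the data by their numbers, and all numbers that occur are at most
    [top S J], where [inord] is faithful for both bounds. *)
Lemma form_data_bound t e : t \in ts ->
  form_data (tr_pre Phi S J N t e) = form_data (tr_pre Phi S J (top S J) t e).
Proof.
case: t => -[q o] q' /ts_bound[qS q'S oJ].
have inordN k : k <= top S J -> nat_of_ord (inord k : 'I_N.+1) = k.
  by move=> kN; rewrite inordK // ltnS (leq_trans kN topN).
have inord_top k : k <= top S J -> nat_of_ord (inord k : 'I_(top S J).+1) = k.
  by move=> kN; rewrite inordK.
have frontN j : j <= J -> front S j <= top S J by rewrite /top /front; lia.
have liveN j : j < J -> live S j <= top S J by rewrite /top /live; lia.
have S_top : S <= top S J by rewrite /top; lia.
have q_top : q <= top S J by rewrite /top; lia.
case: e; case: o oJ => [|j b|j|j b] /= jJ; try (case: b);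
  rewrite /positive; try (case: (j < 2));
  by rewrite /= ?inordN ?inord_top ?frontN ?liveN // ltnW.
Qed.

Lemma action_data_bound t : t \in ts ->
  action_data (tr_action Phi S J N t) =
  action_data (tr_action Phi S J (top S J) t).
Proof.
move=> t_in; rewrite /action_data /=; congr (_, _, _, _, _, _, _).
- by apply: eq_map => e; apply: form_data_bound.
- by apply: eq_map => i; apply: eq_map => e; case: i.
- by apply: eq_map => i; case: i.
Qed.

Lemma prop_atoms_pre t e : prop_atoms (tr_pre Phi S J N t e) = [::].
Proof.
case: t => -[q o] q'; case: e; case: o => [|j b|j|j b] /=; try (case: b);
  by rewrite /positive; try (case: (j < 2)).
Qed.

Lemma machine_task_atoms : task_atoms machine_task = [::].
Proof.
rewrite /task_atoms [prop_atoms _]/= cats0 (_ : flatten _ = [::]) //.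
apply/nilP; rewrite /nilp size_flatten sumnE.
rewrite big1_seq // => _ /= /mapP[_ /mapP[k _ ->] ->].
apply/eqP; rewrite size_cat addn_eq0 !size_flatten !sumnE.
by apply/andP; split; rewrite big1_seq // => _ /= /mapP[_ /mapP[x _ ->] ->];
  rewrite ?prop_atoms_pre //; case: x.
Qed.

End MachineTask.

(* The code of the task of any machine, as a function of [top] and of the code
   of the list of its actions, which are also the two inputs of the machine. *)
Definition task_number (Phi : countType) (v : 2.-tuple nat) : nat :=
  pickle (#|{: agt}|, thead v + tnth v ord_max,
    (#|{: bool}|, [seq rel_data (init_acc i) | i : agt],
     ([::] : seq (nat * seq bool)),
     [seq [seq init_att (thead v) (tnth v ord_max) i w | w : bool] | i : agt],
     (enum_rank true : nat)),
    tnth v ord_max,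
    form_data (Somewhere (has_label Phi 0 0))).

Lemma task_number_computable Phi : computable (task_number Phi).
Proof.
have const (T : countType) (x : T) :
    computable (fun _ : 2.-tuple nat => pickle x).
  exact: computable_const.
have n0P := computable_proj (ord0 : 'I_2).
have n1P := computable_proj (ord_max : 'I_2).
have attP : computable (fun v : 2.-tuple nat => pickle
    [seq [seq init_att (thead v) (tnth v ord_max) i w | w : bool] | i : agt]).
  apply: computable_pickle_seq => i; apply: computable_pickle_seq => w.
  case: i => [[]||]; [exact: n1P | exact: n0P | | exact: computable_const].
  by case: w; [exact: n0P | exact: computable_const].
apply: computable_pickle_pair; last exact: const.
apply: computable_pickle_pair; last exact: n1P.
apply: computable_pickle_pair.
  apply: computable_pickle_pair; first exact: const.
  exact: computable_add n0P n1P.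
apply: computable_pickle_pair; last exact: const.
apply: computable_pickle_pair; last exact: attP.
exact: const.
Qed.

(** * Tasks that know their own code, and the contradiction *)

Lemma pickle_pairE (T U : countType) (x : T) (y : U) :
  pickle (x, y) = CodeSeq.code [:: pickle x; pickle y].
Proof. by []. Qed.

Lemma machine_task_code (Phi : countType) S J ts n (S_gt1 : 1 < S) :
  (forall q o q', (q, o, q') \in ts -> [/\ q < S, q' < S & op_bound J o]) ->
  n = pickle (machine_data Phi S J ts) ->
  task_code (machine_task Phi J ts n S_gt1) =
  task_number Phi [tuple top S J; n].
Proof.
move=> ts_bound nE.
rewrite /task_code /task_number /task_data machine_task_atoms.
set dg := form_data _; set dg' := form_data _.
(* The goal mentions only label 0, which is the same number for every bound. *)
have -> : dg = dg' by rewrite /dg /dg' /= !inordK.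
set da := [seq action_data _ | _ : _].
have -> : da = machine_data Phi S J ts.
  apply: eq_map => k; apply: (action_data_bound _ _ S_gt1 ts_bound).
  exact: mem_tnth.
(* On numbers [pickle] is the identity, so [n] may stand for the list of which it is the code. *)
by rewrite !pickle_pairE -nE.
Qed.

(** The inputs are moved to registers that can be incremented; the last test lets the program halt
    only if the value is 0. *)
Definition main_cmd (f : recfun 2) : cmd :=
  Seqs [:: Move 0 2; Move 1 3; compile f [tuple 2; 3] 4; Op (Test 4 false)].

Lemma main_cmdP f n0 n1 :
  (exists t, sem (main_cmd f) (init_store n0 n1) t) <->
  rec_eval f [tuple n0; n1] 0.
Proof.
set s := init_store n0 n1.
pose s' : store := fun r => match r with 2 => n0 | 3 => n1 | _ => 0 end.
have moved t : (exists2 u, sem (Move 0 2) s u & sem (Move 1 3) u t) <-> t = s'.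
  have E : put (put (put (put s 0 0) 2 n0) 1 0) 3 n1 = s'.
    by apply/funext => -[|[|[|[|r]]]].
  split=> [[u]|->].
    by rewrite !sem_move // => -> ->; rewrite -E /put /= !addn0.
  exists (put (put s 0 0) 2 n0); first by rewrite sem_move // addn0.
  by rewrite sem_move // -E /put /= !addn0.
have fP t : sem (compile f [tuple 2; 3] 4) s' t <->
    exists2 v, rec_eval f [tuple n0; n1] v & t = put s' 4 v.
  rewrite compileP //.
  - have -> // : map_tuple s' [tuple 2; 3] = [tuple n0; n1] by apply/val_inj.
  - by move=> x; rewrite !inE => /orP[]/eqP ->.
  - by case=> [|[|[|[|r]]]].
rewrite /main_cmd; split=> [[t]|f0].
  rewrite !sem_seqs => -[u su]; rewrite sem_seqs => -[u' uu'].
  have -> : u' = s' by apply/moved; exists u.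
  rewrite sem_seqs => -[u2 /fP[v fv ->]]; rewrite sem_seqs => -[u3 [v0 _] _].
  by case: v fv v0.
have [u su us'] := (moved s').2 erefl.
exists (put s' 4 0), u => //; exists s' => //; exists (put s' 4 0).
  by apply/fP; exists 0.
by exists (put s' 4 0).
Qed.

Definition op_reg o :=
  match o with Nop => 0 | Inc j _ | Dec j | Test j _ => j end.

(** Here [n0] is [top] and [n1] the code of the list of actions: the input registers contain exactly
    the data from which the code of the task is computed. *)
Lemma task_of_cmd (Phi : countType) (c : cmd) :
  exists n0 n1 (T : task Phi),
    task_code T = task_number Phi [tuple n0; n1] /\
    (has_solution T <-> exists t, sem c (init_store n0 n1) t).
Proof.
have [S_gt1 halts] : 1 < size (states c) /\ forall s,
    (exists t, rtc (machine_step (transitions c)) (1, s) (0, t)) <->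
    (exists t, sem c s t).
  split; last exact: machineP.
  by rewrite /states /=; case: (conts c _) (mem_conts c [::]).
move: (@transitions_bound c) halts; move: (transitions c) => ts ts_in halts.
(* [J] exceeds every register in use, which yields [op_bound]. *)
pose J := (\max_(t <- ts) op_reg t.1.2).+1.
have ts_bound q o q' : (q, o, q') \in ts ->
    [/\ q < size (states c), q' < size (states c) & op_bound J o].
  move=> t_in; have [qS q'S] := ts_in _ _ _ t_in; split=> //.
  suff : op_reg o < J by case: (o).
  rewrite ltnS.
  by apply: (@leq_bigmax_seq _ _ _ (fun t => op_reg t.1.2) _ t_in).
move: (size _) J S_gt1 {ts_in} ts_bound => S J S_gt1 ts_bound.
move nE: (pickle (machine_data Phi S J ts)) => n.
exists (top S J), n, (machine_task Phi J ts n S_gt1); split.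
  exact: machine_task_code.
exact: iff_trans (machine_task_solution _ _ S_gt1 ts_bound) (halts _).
Qed.

Theorem theorem24 (Phi : countType) :
  ~ rec_decidable (@task_code Phi) (@has_solution Phi).
Proof.
case=> f fP; have [g gP] := task_number_computable Phi.
pose F : recfun 2 := RComp f (fun _ : 'I_1 => g).
have [n0 [n1 [T [codeT solT]]]] := task_of_cmd Phi (main_cmd F).
have solE : has_solution T <-> rec_eval f [tuple task_code T] 0.
  apply: iff_trans solT (iff_trans (main_cmdP _ _ _) _).
  move: (task_code T) codeT => k kE; split=> [[w [/(_ ord0)/gP wE fw]]|f0].
    suff <- : w = [tuple k] by [].
    by apply: eq_from_tnth => i; rewrite !ord1 kE.
  exists [tuple k]; split; last exact: f0.
  by move=> j; apply/gP; rewrite ord1 -kE.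
have [f1 f0] := fP T.
(* Without a solution [f] would give 0, which by [solE] provides one. Hence [T] is solvable, and [f]
   gives both 1 and 0 on its code. *)
have sol : has_solution T by apply: contrapT => nsol; apply/nsol/solE/f0.
by have := rec_eval_fun (f1 sol) (solE.1 sol).
Qed.
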